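(* Let $M$ be a loopless matroid of rank $d+1$ on $E=\{0,1,\dots,n\}$, and regard its Bergman class $\Delta_M\in\operatorname{MW}_d(\Sigma_{A_n})$ as an element of $A^{n-d}(\Sigma_{A_n})$ via the isomorphism $\delta_{\Sigma_{A_n}}:A^\bullet(\Sigma_{A_n})\to\operatorname{MW}_{n-\bullet}(\Sigma_{A_n})$. Then \[A^\bullet(M)\simeq A^\bullet(\Sigma_{A_n})/\operatorname{ann}(\Delta_M),\qquad \operatorname{ann}(\Delta_M)=\{\xi\in A^\bullet(\Sigma_{A_n}):\xi\cdot\Delta_M=0\}.\]
   Context: With $N=\mathbb Z^E/\mathbb Z\mathbf e_E$ and $u_S$ the image of $\sum_{i\in S}\mathbf e_i$, the braid fan $\Sigma_{A_n}$ has cones $\operatorname{Cone}(u_{S_1},\dots,u_{S_k})$ for chains $\emptyset\subsetneq S_1\subsetneq\cdots\subsetneq S_k\subsetneq E$. For a smooth fan $\Sigma$, $A^\bullet(\Sigma)=\mathbb R[x_\rho:\rho\in\Sigma(1)]/(\langle\text{monomials of non-faces}\rangle+\langle\sum_\rho m(u_\rho)x_\rho:m\in N^\vee\rangle)$. $\operatorname{MW}_\ell(\Sigma)$ is the space of balanced functions on $\ell$-cones; the cap product is $(\xi\cap\Delta)(\sigma)=$ value of $\prod_{\rho\in\tau}x_\rho\mapsto\Delta(\tau)$ on $\xi\prod_{\rho\in\sigma}x_\rho$; $\delta_{\Sigma_{A_n}}(\xi)=\xi\cap\Delta_{\Sigma_{A_n}}$ with $\Delta_{\Sigma_{A_n}}\equiv1$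 on $n$-cones is an isomorphism of graded groups. $\Delta_M$ is $1$ on $\operatorname{Cone}(u_{F_1},\dots,u_{F_d})$ with all $F_i$ flats of $M$ and $0$ otherwise. The Chow ring of $M$ is $A^\bullet(M)=A^\bullet(\Sigma_M)=\mathbb R[x_F: F\text{ nonempty proper flat}]/(\langle x_Fx_{F'}: F,F'\text{ incomparable}\rangle+\langle\sum_{F\ni i}x_F-\sum_{F\ni j}x_F: i,j\in E\rangle)$, where $\Sigma_M$ is the subfan of cones of chains of flats. *)

(* Defs.v *)
From HB Require Import structures.
From mathcomp Require Import all_boot all_order all_algebra.
From mathcomp Require Import mpoly.
From mathcomp Require Import reals.

Set Implicit Arguments.
Unset Strict Implicit.
Unset Printing Implicit Defensive.

Import Order.TTheory GRing.Theory Num.Theory.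
Local Open Scope ring_scope.

Record matroid (T : finType) := Matroid {
  mrank : {set T} -> nat;
  mrank_card : forall X, (mrank X <= #|X|)%N;
  mrank_mono : forall X Y : {set T}, X \subset Y -> (mrank X <= mrank Y)%N;
  mrank_submod : forall X Y : {set T},
      (mrank (X :|: Y) + mrank (X :&: Y) <= mrank X + mrank Y)%N }.

Definition flat (T : finType) (M : matroid T) (F : {set T}) : bool :=
  [forall e, (e \notin F) ==> (mrank M F < mrank M (e |: F))%N].

Definition loopless (T : finType) (M : matroid T) : Prop :=
  forall e : T, mrank M [set e] = 1%N.

Notation ray n := {S : {set 'I_n.+1} | (S != set0) && (S != setT)}.

(* a set of rays spans a cone of Sigma_{A_n} iff it is a chain *)
Definition is_chain (n : nat) (C : {set ray n}) : bool :=
  [forall S in C, forall T in C, (val S \subset val T) || (val T \subset val S)].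

Notation PA R n := {mpoly R[#|{: ray n}|]}.

Definition xA (R : nzRingType) (n : nat) (S : ray n) : PA R n := 'X_(enum_rank S).

Definition xmon (R : nzRingType) (n : nat) (C : {set ray n}) : PA R n :=
  \prod_(S in C) xA R S.

Definition in_ideal (R : nzRingType) (k : nat) (G : {mpoly R[k]} -> Prop)
    (p : {mpoly R[k]}) : Prop :=
  exists s : seq ({mpoly R[k]} * {mpoly R[k]}),
    (forall ag, ag \in s -> G ag.2) /\ p = \sum_(ag <- s) ag.1 * ag.2.

(* Generators of the ideal defining A^.(Sigma_{A_n}):
   monomials of non-faces, and sum_rho m(u_rho) x_rho for m in N^vee,
   where N = Z^E / Z e_E, so N^vee = {m : E -> Z | sum_i m_i = 0} and
   m(u_S) = sum_{i in S} m_i. *)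
Definition gen_An (R : nzRingType) (n : nat) (g : PA R n) : Prop :=
  (exists C : {set ray n}, ~~ is_chain C /\ g = xmon R C)
  \/ (exists m : {ffun 'I_n.+1 -> int}, \sum_i m i = 0 /\
        g = \sum_(S : ray n) (\sum_(i in val S) m i)%:~R *: xA R S).

Definition I_An (R : nzRingType) (n : nat) (p : PA R n) : Prop :=
  in_ideal (@gen_An R n) p.

Definition Delta_An (R : nzRingType) (n : nat) (tau : {set ray n}) : R := 1.

(* Cap product: (xi cap Delta_{A_n})(sigma) = v, i.e. v is the value of the
   degree map prod_{rho in tau} x_rho |-> Delta_{A_n}(tau) (tau an n-cone)
   on the class of xi * prod_{rho in sigma} x_rho in A^n(Sigma_{A_n}).   *)
Definition capval (R : nzRingType) (n : nat) (xi : PA R n) (sigma : {set ray n})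
    (v : R) : Prop :=
  exists c : {set ray n} -> R,
    I_An (xi * xmon R sigma -
          \sum_(tau | is_chain tau && (#|tau| == n)) c tau *: xmon R tau)
    /\ v = \sum_(tau | is_chain tau && (#|tau| == n)) c tau * Delta_An R tau.

Definition Delta_M (R : nzRingType) (n : nat) (M : matroid 'I_n.+1)
    (sigma : {set ray n}) : R :=
  if [forall S in sigma, flat M (val S)] then 1 else 0.

(* eta in A^{n-d}(Sigma_{A_n}) with delta_{Sigma_{A_n}}(eta) = Delta_M *)
Definition represents_DeltaM (R : nzRingType) (n d : nat) (M : matroid 'I_n.+1)
    (eta : PA R n) : Prop :=
  eta \is (n - d)%N.-homog /\
  forall sigma : {set ray n}, is_chain sigma -> #|sigma| = d ->
    capval eta sigma (Delta_M R M sigma).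

Notation flatT n M := {S : ray n | flat M (val S)}.

Notation PM R n M := {mpoly R[#|{: flatT n M}|]}.

Definition xM (R : nzRingType) (n : nat) (M : matroid 'I_n.+1) (F : flatT n M)
  : PM R n M := 'X_(enum_rank F).

Definition gen_M (R : nzRingType) (n : nat) (M : matroid 'I_n.+1)
    (g : PM R n M) : Prop :=
  (exists F F' : flatT n M,
      ~~ (val (val F) \subset val (val F')) /\
      ~~ (val (val F') \subset val (val F)) /\ g = xM R F * xM R F')
  \/ (exists i j : 'I_n.+1,
        g = \sum_(F : flatT n M | i \in val (val F)) xM R F
          - \sum_(F : flatT n M | j \in val (val F)) xM R F).

Definition I_M (R : nzRingType) (n : nat) (M : matroid 'I_n.+1)
    (p : PM R n M) : Prop :=
  in_ideal (@gen_M R n M) p.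

(* Main.v *)
Require Import Defs.
From HB Require Import structures.
From mathcomp Require Import all_boot all_order all_algebra.
From mathcomp Require Import mpoly.
From mathcomp Require Import reals.
From mathcomp Require Import zify ring.
Import GRing.Theory.
Local Open Scope ring_scope.

Set Implicit Arguments.
Unset Strict Implicit.
Unset Printing Implicit Defensive.

(* The map f sends x_S to x_S if S is a flat of M and to 0 otherwise.  The theorem
   follows from Poincare duality for A(M) (hence for A(Sigma_An), the case of the
   Boolean matroid): if eta represents Delta_M then deg_An(eta * p) = deg_M(f p), so
   that p * eta = 0 iff f p pairs to 0 with everything iff f p = 0, and eta exists
   because the functional deg_M o f on the degree d part is represented by a class.

   The degree map.  Put x_E = - sum_(i in F) x_F and g_F = sum_(G >= F) x_G.  In the
   variables g_F the relations of A(M) become g_F = 0 for F of rank 1 and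
   (g_F - g_C) (g_G - g_C) = 0 with C the join of F and G, and the functional that is 1
   on the monomials g_{F_1} ... g_{F_d} satisfying the dragon Hall-Rado condition, and 0
   on the others, respects both (Backman, Eur, Simpson).

   Nondegeneracy.  For flats F < G, x_F g_G^(rank G - rank F) = 0, so that A(M) is
   spanned by Feichtner-Yuzvinsky monomials x_{F_1}^{a_1} ... x_{F_m}^{a_m} x_E^e with
   0 < a_i < r_i - r_(i-1), where r_i = rank F_i, and e <= d - r_m.  Pairing with
   x_{F_1}^{r_1 - a_1} x_{F_2}^{r_2 - r_1 - a_2} ... x_E^{d - r_m - e} is unitriangular up
   to sign, since a product of degree d is zero as soon as its part inside some flat F
   has degree less than rank F. *)

(** * Flats and closure in a matroid *)

Section Closure.
Variables (T : finType) (M : matroid T).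
Implicit Types (X Y F G H : {set T}) (e : T).
Local Notation rk := (mrank M).
Local Open Scope nat_scope.

Definition mclosure X : {set T} := [set e | rk (e |: X) == rk X].

Lemma sub_closure X : X \subset mclosure X.
Proof.
by apply/subsetP => e eX; rewrite inE (setUidPr _) // sub1set.
Qed.

(** The elements of [Y] are added one at a time: by submodularity, an element that does not raise
    the rank of [X] does not raise that of a larger set either. *)
Lemma rank_setU_closure X Y : Y \subset mclosure X -> rk (X :|: Y) = rk X.
Proof.
have [k] := ubnP #|Y|; elim: k Y => // k IH Y leYk sYX.
have [->|[e eY]] := set_0Vmem Y; first by rewrite setU0.
have IHY : rk (X :|: (Y :\ e)) = rk X.
  apply: IH; last exact: subset_trans (subD1set _ _) sYX.
  by move: leYk; rewrite (cardsD1 e Y) eY; lia.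
have eX : rk (e |: X) = rk X by have := subsetP sYX _ eY; rewrite inE => /eqP.
have := mrank_submod M (X :|: (Y :\ e)) (e |: X).
have -> : X :|: Y :\ e :|: (e |: X) = X :|: Y.
  by apply/setP => f; rewrite !inE; case: eqP => [->|_] //=; rewrite ?eY ?orbT //= orbAC orbb.
have : rk X <= rk ((X :|: Y :\ e) :&: (e |: X)).
  by apply: mrank_mono; rewrite subsetI subsetUl subsetUr.
have : rk X <= rk (X :|: Y) by apply: mrank_mono; rewrite subsetUl.
by rewrite IHY eX; lia.
Qed.

Lemma rank_closure X : rk (mclosure X) = rk X.
Proof.
by rewrite -(rank_setU_closure (subxx (mclosure X))) (setUidPr (sub_closure X)).
Qed.

Lemma flat_closure X : flat M (mclosure X).
Proof.
apply/forallP => e; apply/implyP; rewrite inE => ne.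
rewrite rank_closure; have : rk (e |: X) <= rk (e |: mclosure X).
  by apply/mrank_mono/setUS/sub_closure.
by have : rk X <= rk (e |: X); [apply/mrank_mono/subsetUr | lia].
Qed.

Lemma closure_min X F : flat M F -> X \subset F -> mclosure X \subset F.
Proof.
move=> fF sXF; apply/subsetP => e; rewrite inE => /eqP eX.
apply: contraT => neF; have := implyP (forallP fF e) neF.
have := mrank_submod M F (e |: X).
have -> : F :|: (e |: X) = e |: F by rewrite setUCA (setUidPl sXF).
have : rk X <= rk (F :&: (e |: X)).
  by apply: mrank_mono; rewrite subsetI sXF subsetUr.
by rewrite eX; lia.
Qed.

Lemma flat_rank_lt F G : flat M F -> F \proper G -> rk F < rk G.
Proof.
move=> fF /properP[sFG [e eG neF]].
apply: leq_trans (implyP (forallP fF e) neF) _.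
by apply: mrank_mono; rewrite subUset sub1set eG.
Qed.

Lemma flat_setT : flat M setT.
Proof. by apply/forallP => e; rewrite inE. Qed.

Lemma rank_set0 : rk set0 = 0.
Proof. by have := mrank_card M set0; rewrite cards0; lia. Qed.

Lemma flat_set0 : loopless M -> flat M set0.
Proof. by move=> Ml; apply/forallP => e; rewrite setU0 Ml rank_set0 implybT. Qed.

Lemma rank_gt0 X : loopless M -> X != set0 -> 0 < rk X.
Proof.
move=> Ml /set0Pn[e eX]; rewrite -[1](Ml e).
by apply: mrank_mono; rewrite sub1set.
Qed.

(** This drives the induction of [flat_var_upper_sum_pow]: passing from the pair [F], [G] to [H] and
    the join of [H] with [G] lowers the rank gap, since [H :&: G] contains [i] besides [F]. *)
Lemma rank_closureU_sub F G H (i : T) : i \notin F -> flat M F ->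
  F \subset H -> F \subset G -> i \in H -> i \in G ->
  rk (mclosure (H :|: G)) + rk F < rk G + rk H.
Proof.
move=> niF fF sFH sFG iH iG; rewrite rank_closure.
have := mrank_submod M H G.
have : rk F < rk (H :&: G).
  apply: flat_rank_lt => //; apply/properP; split; first by rewrite subsetI sFH.
  by exists i; rewrite ?inE ?iH.
by lia.
Qed.

End Closure.

(** * The degree functional *)

(* The dragon Hall-Rado condition of Postnikov, in the form: a multiset of
   nonempty sets, A occurring [m A] times, has fewer than [rank X] members
   inside every nonempty [X]. *)
Section DragonHallRado.
Variables (T : finType) (M : matroid T).
Implicit Types (X Y F G A : {set T}) (m : {set T} -> nat).
Local Notation rk := (mrank M).
Local Open Scope nat_scope.

Definition weight_in m X := \sum_(A : {set T} | (A != set0) && (A \subset X)) m A.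

Definition dhr m := [forall X : {set T}, (X != set0) ==> (weight_in m X < rk X)].

Lemma weight_in_supermodular m X Y :
  weight_in m X + weight_in m Y <= weight_in m (X :|: Y) + weight_in m (X :&: Y).
Proof.
rewrite /weight_in !big_mkcondr -!big_split; apply: leq_sum => A _ /=.
rewrite subsetI; case: (boolP (A \subset X)) => sX; case: (boolP (A \subset Y)) => sY //=;
  by rewrite ?(subsetU (A := A) (B := X) (C := Y)) ?sX ?sY ?orbT //; lia.
Qed.

Lemma weight_in_mono m X Y : X \subset Y -> weight_in m X <= weight_in m Y.
Proof.
move=> sXY; rewrite /weight_in !big_mkcondr; apply: leq_sum => A _.
by case: ifP => // /subset_trans/(_ sXY) ->.
Qed.

Lemma weight_in_set0 m : weight_in m set0 = 0.
Proof.
by rewrite /weight_in big_pred0 // => A; rewrite subset0; case: eqP.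
Qed.

Definition addset m F : {set T} -> nat := fun A => m A + (A == F).

Lemma weight_in_addset m F X : F != set0 ->
  weight_in (addset m F) X = weight_in m X + (F \subset X).
Proof.
move=> nF; rewrite /weight_in /addset big_split /=; congr (_ + _).
rewrite big_mkcond (bigD1 F) //= nF eqxx big1 ?addn0; first by case: (F \subset X).
by move=> A /negPf ->; case: ifP.
Qed.

Let room m k F := [forall X : {set T}, (F \subset X) ==> (weight_in m X + k < rk X)].

(* A set [X] with [~ (weight_in m X + k < rank X)] leaves no room for k more subsets.
   The identity can only fail if such sets for k = 1 exist above both F and G;
   uncrossing them, their union leaves no room for two copies of C. *)
Lemma dhr_uncross m F G : F != set0 -> G != set0 ->
  let C := mclosure M (F :|: G) in
  dhr (addset (addset m F) G) + dhr (addset (addset m C) C)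
  = dhr (addset (addset m F) C) + dhr (addset (addset m G) C).
Proof.
move=> nF nG C; have sFG : F :|: G \subset C := sub_closure M _.
have sFC : F \subset C by apply: subset_trans (subsetUl _ _) sFG.
have sGC : G \subset C by apply: subset_trans (subsetUr _ _) sFG.
have nz X A : A != set0 -> A \subset X -> X != set0.
  by move=> nA; apply: contraTneq => ->; rewrite subset0.
have nC : C != set0 := nz _ _ nF sFC.
(* With [A] inside [C], the two new members cost one place on sets above [A] and two on sets above
   [C]. *)
have E1 A : A != set0 -> A \subset C ->
    dhr (addset (addset m A) C) = [&& dhr m, room m 1 A & room m 2 C].
  move=> nA sAC; apply/forallP/and3P => [h|[/forallP h1 /forallP h2 /forallP h3] X].
    split; apply/forallP => X; apply/implyP => hX.
    - by have := implyP (h X) hX; rewrite !weight_in_addset //; clear; lia.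
    - by have := implyP (h X) (nz _ _ nA hX); rewrite !weight_in_addset // hX; clear; lia.
    - have := implyP (h X) (nz _ _ nC hX).
      by rewrite !weight_in_addset // hX (subset_trans sAC hX); clear; lia.
  apply/implyP => hX; rewrite !weight_in_addset //.
  have [sAX|nAX] := boolP (A \subset X); last first.
    have -> : (C \subset X) = false by apply: contraNF nAX; exact: subset_trans.
    by have := implyP (h1 X) hX; clear; lia.
  have [sCX|nCX] := boolP (C \subset X); last by have := implyP (h2 X) sAX; clear; lia.
  by have := implyP (h3 X) sCX; clear; lia.
have E2 : dhr (addset (addset m F) G)
    = [&& dhr m, room m 1 F, room m 1 G & room m 2 C].
  apply/forallP/and4P => [h|[/forallP h1 /forallP h2 /forallP h3 /forallP h4] X].
    split; apply/forallP => X; apply/implyP => hX.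
    - by have := implyP (h X) hX; rewrite !weight_in_addset //; clear; lia.
    - by have := implyP (h X) (nz _ _ nF hX); rewrite !weight_in_addset // hX; clear; lia.
    - by have := implyP (h X) (nz _ _ nG hX); rewrite !weight_in_addset // hX; clear; lia.
    - have := implyP (h X) (nz _ _ nC hX); rewrite !weight_in_addset //.
      by rewrite (subset_trans sFC hX) (subset_trans sGC hX); clear; lia.
  apply/implyP => hX; rewrite !weight_in_addset //.
  have [sFX|nFX] := boolP (F \subset X); last first.
    have [sGX|nGX] := boolP (G \subset X); last by have := implyP (h1 X) hX; clear; lia.
    by have := implyP (h3 X) sGX; clear; lia.
  have [sGX|nGX] := boolP (G \subset X); last by have := implyP (h2 X) sFX; clear; lia.
  (* [X] itself need not contain [C]; its closure does, with the same rank and no less weight. *)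
  have sC : C \subset mclosure M X.
    apply: closure_min (flat_closure _ _) _.
    by apply: subset_trans (sub_closure M X); rewrite subUset sFX.
  have := implyP (h4 _) sC; rewrite rank_closure.
  by have := weight_in_mono m (sub_closure M X); clear; lia.
rewrite E2 !E1 //.
have -> : room m 1 C && room m 2 C = room m 2 C.
  apply: andb_idl => /forallP h; apply/forallP => X; apply/implyP => hX.
  by have := implyP (h X) hX; clear; lia.
suff: dhr m -> room m 2 C -> room m 1 F || room m 1 G.
  case: (dhr m) => //; case: (room m 2 C); last by rewrite !andbF.
  by case: (room m 1 F); case: (room m 1 G) => // /(_ isT isT).
move=> /forallP hm /forallP hC; apply: contraT; rewrite negb_or => /andP[].
move=> /forallPn[X]; rewrite negb_imply => /andP[sFX hX].
move=> /forallPn[Y]; rewrite negb_imply => /andP[sGY hY].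
have sC : C \subset mclosure M (X :|: Y).
  apply: closure_min (flat_closure _ _) _.
  by apply: subset_trans (sub_closure M _); apply: setUSS.
have := implyP (hC _) sC; rewrite rank_closure.
move: hX hY; have := weight_in_mono m (sub_closure M (X :|: Y)).
have := weight_in_supermodular m X Y; have := mrank_submod M X Y.
(* The condition [hm] speaks of nonempty sets only; for disjoint [X] and [Y] the intersection has
   weight 0. *)
have [->|nI] := eqVneq (X :&: Y) set0; first by rewrite weight_in_set0; clear; lia.
by have := implyP (hm _) nI; clear; lia.
Qed.

Lemma dhr_addset_rank1 m F : F != set0 -> rk F <= 1 -> ~~ dhr (addset m F).
Proof.
move=> nF rF; apply/negP => /forallP/(_ F)/implyP/(_ nF).
by rewrite weight_in_addset // subxx; lia.
Qed.

End DragonHallRado.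

Section DegreeOnSets.
Variables (R : fieldType) (T : finType) (M : matroid T) (d : nat).
Implicit Types (F G A : {set T}).
Local Notation SP := {mpoly R[#|{set T}|]}.
Local Notation g A := ('X_(enum_rank A) : SP).

Definition dhr_mnm (m : 'X_{1..#|{set T}|}) : bool :=
  (mdeg m == d) && dhr M (fun A => m (enum_rank A)).

Definition dhr_deg (p : SP) : R :=
  \sum_(m : 'X_{1..#|{set T}| < d.+1}) p@_m * (dhr_mnm m)%:R.

Lemma dhr_deg_is_linear : linear_for *%R dhr_deg.
Proof.
move=> c p q; rewrite /dhr_deg mulr_sumr -big_split; apply: eq_bigr => m _ /=.
by rewrite mcoeffD mcoeffZ mulrDl mulrA.
Qed.

HB.instance Definition _ := GRing.isLinear.Build R SP R *%R dhr_deg dhr_deg_is_linear.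

Lemma dhr_degX m : dhr_deg 'X_[m] = (dhr_mnm m)%:R.
Proof.
rewrite /dhr_deg; have [lt_md|ge_md] := ltnP (mdeg m) d.+1.
  rewrite (bigD1 (Sub m lt_md)) //= mcoeffX eqxx mul1r big1 ?addr0 // => m'.
  by rewrite -val_eqE /= mcoeffX eq_sym => /negPf ->; rewrite mul0r.
rewrite {2}/dhr_mnm gtn_eqF // big1 // => m' _; rewrite mcoeffX.
by case: eqP => [E|]; rewrite ?mul0r //; have := bmdeg m'; rewrite -E ltnNge ge_md.
Qed.

Lemma linear_mnm_eq0 n (D : {linear {mpoly R[n]} -> R | *%R}) p :
  (forall m, D (p * 'X_[m]) = 0) -> forall q, D (p * q) = 0.
Proof.
move=> h q; rewrite (mpolyE q) mulr_sumr linear_sum big1 // => m _.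
by rewrite -scalerAr linearZ /= h mulr0.
Qed.

Lemma mnm_addset (m : 'X_{1..#|{set T}|}) F :
  (fun A => (U_(enum_rank F) + m)%MM (enum_rank A)) =1
  addset (fun A => m (enum_rank A)) F.
Proof.
by move=> A; rewrite mnmDE mnm1E (inj_eq enum_rank_inj) eq_sym addnC.
Qed.

Lemma eq_dhr (m1 m2 : {set T} -> nat) : m1 =1 m2 -> dhr M m1 = dhr M m2.
Proof.
move=> E; apply: eq_forallb => X; congr (_ ==> (_ < _)%N).
by apply: eq_bigr => A _.
Qed.

Lemma dhr_mnm2 m F G : dhr_mnm (U_(enum_rank F) + (U_(enum_rank G) + m)) =
  (mdeg m + 2 == d)%N && dhr M (addset (addset (fun A => m (enum_rank A)) F) G).
Proof.
rewrite /dhr_mnm !mdegD !mdeg1 addnA addnC; congr (_ && _).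
apply: eq_dhr => A; rewrite mnm_addset /addset mnmDE mnm1E (inj_eq enum_rank_inj).
by rewrite (eq_sym G) -addnA addnC.
Qed.

Lemma dhr_deg_rank1 F : F != set0 -> (mrank M F <= 1)%N ->
  forall q, dhr_deg (g F * q) = 0.
Proof.
move=> nF rF; apply: linear_mnm_eq0 => m /=; rewrite -mpolyXD dhr_degX.
rewrite /dhr_mnm (eq_dhr (mnm_addset _ _)).
by rewrite (negPf (dhr_addset_rank1 _ nF rF)) // andbF.
Qed.

(** The product expands to g_F g_G + g_C g_C - g_F g_C - g_G g_C, and [dhr_uncross] balances these
    four terms on every monomial. *)
Lemma dhr_deg_uncross F G : F != set0 -> G != set0 ->
  let C := mclosure M (F :|: G) in
  forall q, dhr_deg ((g F - g C) * (g G - g C) * q) = 0.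
Proof.
move=> nF nG C; apply: linear_mnm_eq0 => m /=.
have -> : (g F - g C) * (g G - g C) * 'X_[m] =
    (g F * (g G * 'X_[m]) + g C * (g C * 'X_[m]))
    - (g F * (g C * 'X_[m]) + g G * (g C * 'X_[m])) by ring.
rewrite -!mpolyXD linearB !linearD /= !dhr_degX !dhr_mnm2 -!natrD.
case: (_ == d); rewrite //= ?subrr //.
by rewrite (dhr_uncross M _ nF nG) subrr.
Qed.

(** The normalisation: [d] copies of E weigh [d], below the rank, on E itself and nothing on any
    other set. *)
Lemma dhr_degT : loopless M -> mrank M setT = d.+1 -> dhr_deg (g setT ^+ d) = 1.
Proof.
move=> Ml rE; rewrite mpolyXn dhr_degX /dhr_mnm mdegMn mdeg1 mul1n eqxx /=.
suff -> : dhr M (fun A => (U_(enum_rank [set: T]) *+ d)%MM (enum_rank A)) by [].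
apply/forallP => X; apply/implyP => nX.
rewrite /weight_in (eq_bigr (fun A => (A == setT) * d)%N); last first.
  by move=> A _; rewrite mulmnE mnm1E (inj_eq enum_rank_inj) eq_sym.
have [->|nXT] := eqVneq X setT.
  rewrite rE ltnS (bigD1 setT) //=; last first.
    rewrite subxx andbT; apply/eqP => T0.
    by have := rank_set0 M; rewrite -T0 rE.
  by rewrite eqxx mul1n big1 ?addn0 // => A /andP[_ /negPf ->].
rewrite big1 ?rank_gt0 // => A /andP[_ sAX].
by case: eqP sAX => // ->; rewrite subTset (negPf nXT).
Qed.

(* The inverse of the change of variables g_F = \sum_(G >= F) xi_G over flats. *)
Fixpoint xi_rec (j : nat) F : SP :=
  if j is j'.+1 then g F - \sum_(G | flat M G && (F \proper G)) xi_rec j' G else 0.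

Definition xi F : SP := xi_rec #|T|.+1 F.

(** The first argument is fuel: the recursion passes to strictly larger flats, so any amount above
    the size of the complement gives the same value. *)
Lemma xi_rec_stable j F : (#|~: F| < j)%N -> xi_rec j F = xi F.
Proof.
rewrite /xi; have : (#|~: F| < #|T|.+1)%N by rewrite ltnS max_card.
move: #|T|.+1 => j'; elim: j j' F => [|j IH] [|j'] F //=.
rewrite !ltnS => h1 h2; congr (_ - _); apply: eq_bigr => G /andP[_ pFG].
have ltG : (#|~: G| < #|~: F|)%N by apply: proper_card; rewrite properC.
by apply: IH; [exact: leq_trans ltG h1 | exact: leq_trans ltG h2].
Qed.

Lemma xiE F : xi F = g F - \sum_(G | flat M G && (F \proper G)) xi G.
Proof.
rewrite {1}/xi /=; congr (_ - _); apply: eq_bigr => G /andP[_ pFG].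
apply: xi_rec_stable; have : (#|~: G| < #|~: F|)%N by apply: proper_card; rewrite properC.
by move=> /leq_trans -> //; apply: max_card.
Qed.

Lemma sum_xi F : flat M F -> \sum_(G | flat M G && (F \subset G)) xi G = g F.
Proof.
move=> fF; rewrite (bigD1 F) ?fF ?subxx //= [xi F]xiE.
rewrite (eq_bigl (fun G => flat M G && (F \proper G))) ?subrK // => G.
by rewrite properEneq -andbA (eq_sym F); congr (_ && _); rewrite andbC.
Qed.

(** Downward induction on the pair. By inversion, (g_F - g_C) (g_G - g_C) is the sum of the xi_H
    xi_K with H above F but not G, and K above G but not F. All these pairs are incomparable, and
    all but (F, G) itself are covered by induction. *)
Lemma dhr_deg_incomparable F G : flat M F -> flat M G ->
  ~~ (F \subset G) -> ~~ (G \subset F) -> forall q, dhr_deg (xi F * xi G * q) = 0.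
Proof.
have [n] := ubnP (#|~: F| + #|~: G|); elim: n F G => // n IH F G le_n fF fG nFG nGF q.
have nF : F != set0 by apply: contraNneq nFG => ->; rewrite sub0set.
have nG : G != set0 by apply: contraNneq nGF => ->; rewrite sub0set.
pose C := mclosure M (F :|: G).
have E A B : flat M A -> A :|: B = F :|: G ->
    g A - g C = \sum_(K | (flat M K && (A \subset K)) && ~~ (B \subset K)) xi K.
  move=> fA EAB; rewrite -(sum_xi fA) -(sum_xi (flat_closure M _)).
  rewrite (bigID (fun K : {set T} => B \subset K)) /=.
  rewrite [X in X + _ - _](_ : _ = \sum_(K | flat M K && (C \subset K)) xi K).
    by rewrite addrAC subrr add0r.
  apply: eq_bigl => K; rewrite -andbA -subUset EAB.
  apply: andb_id2l => fK; apply/idP/idP; first exact: closure_min.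
  exact: subset_trans (sub_closure M _).
have := dhr_deg_uncross nF nG q; rewrite -/C.
rewrite (E F G) // (E G F) ?[G :|: F]setUC // big_distrlr /= mulr_suml linear_sum.
rewrite (bigD1 F) ?fF ?subxx //= mulr_suml linear_sum (bigD1 G) ?fG ?subxx //=.
have ltc (A B : {set T}) : A \subset B -> B != A -> (#|~: B| < #|~: A|)%N.
  by move=> sAB nAB; apply: proper_card; rewrite properC properEneq eq_sym nAB.
rewrite [X in _ + X + _]big1 ?addr0; last first.
  move=> K /andP[/andP[/andP[fK sGK] nFK] neK]; apply: IH => //.
    by have := ltc _ _ sGK neK; move: le_n; clear; lia.
  by apply: contraNN nGF; apply: subset_trans.
rewrite [X in _ + X]big1 ?addr0 // => H /andP[/andP[/andP[fH sFH] nGH] neH].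
rewrite mulr_suml linear_sum big1 // => K /andP[/andP[fK sGK] nFK].
have leK : (#|~: K| <= #|~: G|)%N by apply: subset_leq_card; rewrite setCS.
apply: IH => //; first by have := ltc _ _ sFH neH; move: le_n leK; clear; lia.
  by apply: contraNN nFK; apply: subset_trans.
by apply: contraNN nGH; apply: subset_trans.
Qed.

End DegreeOnSets.

Lemma comp_mpoly_dhomog (R : comNzRingType) (n k e : nat) (lq : n.-tuple {mpoly R[k]})
    (p : {mpoly R[n]}) :
  (forall i, tnth lq i \is 1.-homog) -> p \is e.-homog -> p \mPo lq \is e.-homog.
Proof.
move=> hq /dhomogP hp; rewrite comp_mpolyEX big_seq rpred_sum // => m /hp <-.
apply: rpredZ; rewrite comp_mpolyX /= mdegE.
apply: (big_rec2 (fun p e => p \is e.-homog)) => [|i p' e' _]; first exact: dhomog1.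
by apply: dhomogM; have := dhomogMn (m i) (hq i); rewrite mul1n.
Qed.

Lemma mpolyX_list (R : nzRingType) (k : nat) (m : 'X_{1..k}) :
  exists2 r : seq 'I_k, size r = mdeg m & 'X_[m] = \prod_(a <- r) 'X_a :> {mpoly R[k]}.
Proof.
exists (flatten [seq nseq (m a) a | a <- index_enum 'I_k]).
  rewrite size_flatten /shape -map_comp sumnE big_map mdegE.
  by apply: eq_bigr => a _; rewrite /= size_nseq.
rewrite big_flatten big_map mpolyXE_id; apply: eq_bigr => a _.
by elim: (m a) => [|e IH]; rewrite ?big_nil // big_cons exprS IH.
Qed.

(** * Chow rings presented by labelled flats *)

Section Presentation.
Variables (R : fieldType) (T : finType) (M : matroid T) (k : nat) (phi : 'I_k -> {set T}).
Local Notation P := {mpoly R[k]}.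

(** The variables of both rings are numbered by an ordinal; [phi] tells which flat a variable stands
    for, so that one development serves [M] and the Boolean matroid. *)
Record flat_labelling : Prop := FlatLabelling {
  label_inj : injective phi;
  label_flat : forall a, flat M (phi a);
  label_neq0 : forall a, phi a != set0;
  label_neqT : forall a, phi a != setT;
  label_onto : forall F, flat M F -> F != set0 -> F != setT -> exists a, phi a = F }.

(** Any ideal with the relations of the Chow ring qualifies, not only the smallest. The polynomials
    that the degree map kills after every multiplication form another one, so minimality of [I_An]
    and [I_M] makes the degree maps vanish on them. *)
Record chow_ideal (I : P -> Prop) : Prop := ChowIdeal {
  chow_ideal0 : I 0;
  chow_idealD : forall p q, I p -> I q -> I (p + q);
  chow_idealM : forall p q, I q -> I (p * q);
  ideal_incomparable : forall a b, ~~ (phi a \subset phi b) -> ~~ (phi b \subset phi a) ->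
    I ('X_a * 'X_b);
  ideal_linear : forall i j,
    I (\sum_(a | i \in phi a) 'X_a - \sum_(a | j \in phi a) 'X_a) }.

End Presentation.

Section FlatDegree.
Variables (R : fieldType) (T : finType) (M : matroid T) (d k : nat).
Variable phi : 'I_k -> {set T}.
Local Notation P := {mpoly R[k]}.

Definition xi_tuple := [tuple xi R M (phi a) | a < k].

(** [dhr_deg] is 1 on the image of the [d]-th power of x_E; the sign moves the value 1 to the
    product along a maximal flag of flats. *)
Definition flat_deg (p : P) : R := (-1) ^+ d * dhr_deg M d (p \mPo xi_tuple).

Lemma flat_deg_is_linear : linear_for *%R flat_deg.
Proof.
by move=> c p q; rewrite /flat_deg 2!linearP /= mulrDr mulrCA.
Qed.

HB.instance Definition _ := GRing.isLinear.Build R P R *%R flat_deg flat_deg_is_linear.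

Lemma xi_dhomog F : xi R M F \is 1.-homog.
Proof.
rewrite /xi; elim: #|T|.+1 F => [|j IH] F /=; first exact: dhomog0.
by rewrite rpredB ?rpred_sum // dhomogX /= mdeg1.
Qed.

Lemma dhr_deg_homog e p : p \is e.-homog -> e != d -> dhr_deg (R := R) M d p = 0.
Proof.
move=> hp ne; rewrite /dhr_deg big1 // => m _; rewrite /dhr_mnm.
have [md|_] := eqVneq (mdeg m) d; rewrite ?mulr0 //.
by rewrite (dhomog_nemf_coeff hp) ?mul0r //= md eq_sym.
Qed.

Lemma flat_deg_homog e p : p \is e.-homog -> e != d -> flat_deg p = 0.
Proof.
move=> hp ne; rewrite /flat_deg (dhr_deg_homog (e := e)) ?mulr0 //.
by apply: comp_mpoly_dhomog => // i; rewrite tnth_mktuple xi_dhomog.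
Qed.

Hypothesis Ml : loopless M.
Hypothesis rE : mrank M setT = d.+1.
Hypothesis phiP : flat_labelling M phi.

Lemma comp_xi a : ('X_a : P) \mPo xi_tuple = xi R M (phi a).
Proof. by rewrite comp_mpolyXU -tnth_nth tnth_mktuple. Qed.

Lemma rank_setT_neq0 : [set: T] != set0.
Proof. by apply/eqP => T0; have := rank_set0 M; rewrite -T0 rE. Qed.

Lemma sum_label (V : zmodType) (h : {set T} -> V) (Q : pred {set T}) :
  \sum_(F | [&& flat M F, F != set0, F != setT & Q F]) h F = \sum_(a | Q (phi a)) h (phi a).
Proof.
(* The inverse of [phi] needs a default label [a0]; if there is none, both sums are empty. *)
have [E|[F0]] := set_0Vmem [set F | [&& flat M F, F != set0 & F != setT]].
  rewrite !big1 // => [a _|F /and4P[fF nF0 nFT _]].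
    have /setP/(_ (phi a)) := E.
    by rewrite !inE (label_flat phiP) ?(label_neq0 phiP) ?(label_neqT phiP).
  by have /setP/(_ F) := E; rewrite !inE fF nF0 nFT.
rewrite inE => /and3P[fF0 nF0 nTF0]; have [a0 _] := label_onto phiP fF0 nF0 nTF0.
rewrite (reindex_onto phi (fun F => odflt a0 [pick a | phi a == F])) /=.
  apply: eq_bigl => a; rewrite (label_flat phiP) ?(label_neq0 phiP) ?(label_neqT phiP) //=.
  case: pickP => [b /eqP /(label_inj phiP) ->|/(_ a)]; last by rewrite eqxx.
  by rewrite eqxx andbT.
move=> F /and4P[fF nF nT _]; case: pickP => [b /eqP //|none].
by case: (label_onto phiP fF nF nT) => a E; have := none a; rewrite E eqxx.
Qed.

(** The flats through [i] are those above the closure of [i], and E is the only one of them without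
    a label. *)
Lemma sum_xi_mem i :
  \sum_(a | i \in phi a) xi R M (phi a) = 'X_(enum_rank (mclosure M [set i])) - xi R M setT.
Proof.
rewrite -(sum_label (fun F => xi R M F) (fun F => i \in F)).
rewrite -(sum_xi _ (flat_closure M _)) [in RHS](bigD1 setT) /= ?flat_setT ?subsetT //.
rewrite [RHS]addrAC subrr add0r; apply: eq_bigl => F; rewrite -andbA; apply: andb_id2l => fF.
apply/and3P/andP => [[_ nT iF]|[s nT]]; first by rewrite nT closure_min // sub1set.
have iF : i \in F by rewrite -sub1set (subset_trans (sub_closure M _) s).
by split=> //; apply/set0Pn; exists i.
Qed.

(** In the linear relation the terms xi_E cancel, leaving two variables g of rank 1, which [dhr_deg]
    kills. Quantifying over [q] turns the kernel into an ideal. *)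
Lemma flat_deg_ideal : chow_ideal phi (fun p : P => forall q, flat_deg (p * q) = 0).
Proof.
split.
- by move=> q; rewrite mul0r raddf0.
- by move=> p1 p2 h1 h2 q; rewrite mulrDl raddfD /= h1 h2 addr0.
- by move=> p1 p2 h2 q; rewrite [p1 * p2]mulrC -mulrA h2.
- move=> a b nab nba q; rewrite /flat_deg !rmorphM /= !comp_xi.
  by rewrite dhr_deg_incomparable ?mulr0 // (label_flat phiP).
move=> i j q; rewrite /flat_deg rmorphM rmorphB /= !rmorph_sum /=.
rewrite (eq_bigr _ (fun a _ => comp_xi a)) [X in _ - X](eq_bigr _ (fun a _ => comp_xi a)).
rewrite !sum_xi_mem; move: (xi R M setT) => x; rewrite opprB addrA subrK mulrBl raddfB /=.
have K e q' : dhr_deg M d ('X_(enum_rank (mclosure M [set e])) * q' : {mpoly R[_]}) = 0.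
  apply: dhr_deg_rank1; last by rewrite rank_closure Ml.
  by apply/set0Pn; exists e; apply: (subsetP (sub_closure _ _)); rewrite inE.
by rewrite !K subrr mulr0.
Qed.

End FlatDegree.

(** * Relations among the variables of flats *)

Section FlatVariables.
Variables (R : fieldType) (T : finType) (M : matroid T) (d k : nat).
Variables (phi : 'I_k -> {set T}) (i0 : T).
Local Notation P := {mpoly R[k]}.
Implicit Types (F G H : {set T}).
Local Notation rk := (mrank M).

(* With [flat_var setT] standing for x_E, the linear relations say that the sum
   of all variables of flats through a given element vanishes. *)
Definition flat_var (F : {set T}) : P :=
  if F == set0 then 1
  else if F == setT then - \sum_(a | i0 \in phi a) 'X_a
  else \sum_(a | phi a == F) 'X_a.

Local Notation y := flat_var.

(** The g_G of the degree map, read in the ring itself with x_E included. *)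
Definition upper_sum (G : {set T}) : P := \sum_(H | flat M H && (G \subset H)) y H.

Hypothesis Ml : loopless M.
Hypothesis rE : rk setT = d.+1.
Hypothesis phiP : flat_labelling M phi.
Variable I : P -> Prop.
Hypothesis hI : chow_ideal phi I.

(** This value lets statements about [y F] times a product over flats above [F] start at the empty
    flat. *)
Lemma flat_var0 : y set0 = 1. Proof. by rewrite /y eqxx. Qed.

Lemma flat_var_label a : y (phi a) = 'X_a.
Proof.
rewrite /y (negPf (label_neq0 phiP a)) (negPf (label_neqT phiP a)).
by rewrite (big_pred1 a) // => b; rewrite (inj_eq (label_inj phiP)).
Qed.

Lemma flat_var_homog F : F != set0 -> y F \is 1.-homog.
Proof.
have X1 a : ('X_a : P) \is 1.-homog by rewrite dhomogX /= mdeg1.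
by move=> nF; rewrite /y (negPf nF); case: ifP => _; rewrite ?rpredN ?rpred_sum.
Qed.

Lemma chow_idealN p : I p -> I (- p).
Proof. by move=> Ip; rewrite -mulN1r; exact: (chow_idealM hI). Qed.

Lemma chow_idealB p q : I p -> I q -> I (p - q).
Proof. by move=> Ip Iq; apply: (chow_idealD hI Ip (chow_idealN Iq)). Qed.

Lemma chow_idealMr p q : I p -> I (p * q).
Proof. by rewrite mulrC; exact: (chow_idealM hI). Qed.

Lemma chow_idealZ c p : I p -> I (c *: p).
Proof. by rewrite -mul_mpolyC; exact: (chow_idealM hI). Qed.

Lemma ideal_sum (J : Type) (r : seq J) (Q : pred J) (h : J -> P) :
  (forall j, Q j -> I (h j)) -> I (\sum_(j <- r | Q j) h j).
Proof.
by move=> hh; apply: big_rec => [|j p /hh]; [exact: (chow_ideal0 hI) | exact: (chow_idealD hI)].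
Qed.

Lemma ideal_congr p q : I (p - q) -> I q -> I p.
Proof. by move=> h1 h2; rewrite -(subrK q p); apply: (chow_idealD hI h1 h2). Qed.

Lemma ideal_pow w u v c : I (w * (u - v)) -> I (w * (u ^+ c - v ^+ c)).
Proof. by move=> h; rewrite subrXX mulrA; apply: chow_idealMr. Qed.

Lemma flat_var_sum i : I (\sum_(F | flat M F && (i \in F)) y F).
Proof.
rewrite (bigD1 setT) ?flat_setT ?inE //=.
rewrite (eq_bigl (fun F => [&& flat M F, F != set0, F != setT & i \in F])).
  rewrite (sum_label phiP) (eq_bigr _ (fun a _ => flat_var_label a)).
  rewrite /y (negPf (rank_setT_neq0 rE)) eqxx addrC.
  exact: (ideal_linear hI _ _).
move=> F; rewrite -andbA; apply: andb_id2l => fF.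
have [->|_] := eqVneq F set0; first by rewrite inE.
by rewrite andbC.
Qed.

Lemma flat_var_incomparable F G : flat M F -> flat M G ->
  ~~ (F \subset G) -> ~~ (G \subset F) -> I (y F * y G).
Proof.
move=> fF fG nFG nGF.
have nF : F != set0 by apply: contraNneq nFG => ->; rewrite sub0set.
have nG : G != set0 by apply: contraNneq nGF => ->; rewrite sub0set.
have nFT : F != setT by apply: contraNneq nGF => ->; rewrite subsetT.
have nGT : G != setT by apply: contraNneq nFG => ->; rewrite subsetT.
have [a Ea] := label_onto phiP fF nF nFT.
have [b Eb] := label_onto phiP fG nG nGT.
move: nFG nGF; rewrite -Ea -Eb !flat_var_label; exact: (ideal_incomparable hI).
Qed.

Lemma upper_sumT : upper_sum setT = y setT.
Proof.
rewrite /upper_sum (big_pred1 setT) // => H.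
by rewrite subTset andb_idl // => /eqP ->; exact: flat_setT.
Qed.

(** A flat [L] above [G] but not above the join is incomparable with [H]: below [H] it would put [G]
    there, above [H] it would contain the join. *)
Lemma upper_sum_mclosure H G : flat M H -> H != set0 -> ~~ (G \subset H) ->
  I (y H * (upper_sum G - upper_sum (mclosure M (H :|: G)))).
Proof.
move=> fH nH nGH; rewrite /upper_sum (bigID (fun L : {set T} => mclosure M (H :|: G) \subset L)) /=.
rewrite [X in X + _ - _](eq_bigl (fun L : {set T} => flat M L && (mclosure M (H :|: G) \subset L))).
  rewrite addrAC subrr add0r mulr_sumr; apply: ideal_sum => L /andP[/andP[fL sGL] nL].
  have nLH : ~~ (L \subset H) by apply: contraNN nGH; apply: subset_trans sGL.
  apply: flat_var_incomparable => //; apply: contraNN nL => sHL.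
  by rewrite closure_min // subUset sHL.
move=> L; rewrite -andbA; apply: andb_id2l => fL; apply: andb_idl => sL.
by apply: subset_trans sL; apply: subset_trans (sub_closure _ _); apply: subsetUr.
Qed.

(** Pick [i] in [G] outside [F]. By the linear relation, g_G is minus the sum of the y_H with [i] in
    [H] and [H] not above [G]. Such an [H] is incomparable with [F] or above it; in the second case
    y_H allows replacing g_G by g_K with [K] the join of [H] and [G], and the rank gap has
    dropped. *)
Lemma flat_var_upper_sum_pow c F G : flat M F -> flat M G -> F \proper G ->
  (rk G <= rk F + c)%N -> I (y F * upper_sum G ^+ c).
Proof.
elim: c F G => [|c IH] F G fF fG pFG le_r.
  by have := flat_rank_lt fF pFG; lia.
have [sFG [i iG niF]] := properP pFG.
have E : upper_sum G = \sum_(H | flat M H && (i \in H)) y H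
    - \sum_(H | flat M H && (i \in H) && ~~ (G \subset H)) y H.
  rewrite [X in X - _](bigID (fun H : {set T} => G \subset H)) /= addrK.
  apply: eq_bigl => H; rewrite -andbA; apply: andb_id2l => _.
  by apply/esym/andb_idl => /subsetP; apply.
rewrite exprSr {2}E !mulrA mulrBr; apply: chow_idealB.
  exact: (chow_idealM hI _ (flat_var_sum i)).
rewrite mulr_sumr; apply: ideal_sum => H /andP[/andP[fH iH] nGH].
have nH : H != set0 by apply/set0Pn; exists i.
have nHF : ~~ (H \subset F) by apply: contraNN niF => /subsetP; apply.
rewrite mulrAC; have [sFH|nFH] := boolP (F \subset H); last first.
  by apply: chow_idealMr; exact: flat_var_incomparable.
rewrite -mulrA; apply: (chow_idealM hI).
pose K := mclosure M (H :|: G); apply: (@ideal_congr _ (y H * upper_sum K ^+ c)).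
  rewrite -mulrBr; exact/ideal_pow/upper_sum_mclosure.
have sK : H :|: G \subset K := sub_closure M _.
apply: IH => //; first exact: flat_closure.
  rewrite properEneq (subset_trans (subsetUl H G) sK) andbT.
  apply: contraNneq nGH => ->; exact: subset_trans (subsetUr H G) sK.
by have := rank_closureU_sub niF fF sFH sFG iH iG; rewrite -/K; move: le_r; clear; lia.
Qed.

Lemma flat_varT_pow e F : flat M F -> F != setT -> (d < rk F + e)%N ->
  I (y F * y setT ^+ e).
Proof.
move=> fF nF le; rewrite -upper_sumT; apply: flat_var_upper_sum_pow => //.
- exact: flat_setT.
- by rewrite properEneq nF subsetT.
by rewrite rE; lia.
Qed.

(** Against y_E^e no flat strictly between [G] and E survives, so g_G acts as y_G + y_E; as y_G
    y_E^(e+1) vanishes, g_G^c acts as y_G^c + y_E^c. Finally y_F g_G^c vanishes. *)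
Lemma flat_var_diagonal F G c e : flat M F -> flat M G -> F \proper G -> G != setT ->
  (rk G = rk F + c)%N -> (rk G + e = d)%N ->
  I (y F * y G ^+ c * y setT ^+ e + y F * y setT ^+ (c + e)).
Proof.
move=> fF fG pFG nG Ec Ee.
have c_gt0 : (0 < c)%N by have := flat_rank_lt fF pFG; lia.
have IGE : I (y G * y setT ^+ e.+1) by apply: flat_varT_pow => //; lia.
have E1 : I (y setT ^+ e * (upper_sum G - (y G + y setT))).
  rewrite /upper_sum (bigD1 G) ?fG ?subxx //=.
  rewrite (bigD1 setT) ?flat_setT ?subsetT //=; last by rewrite eq_sym nG.
  rewrite addrA [X in X - _]addrC addrK mulr_sumr; apply: ideal_sum => H.
  move=> /andP[/andP[/andP[fH sGH] nHG] nHT]; rewrite mulrC.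
  apply: flat_varT_pow => //.
  have : (rk G < rk H)%N by apply: flat_rank_lt; rewrite // properEneq eq_sym nHG.
  by lia.
have E : I (y setT ^+ e * (upper_sum G ^+ c - (y G ^+ c + y setT ^+ c))).
  (* The induction starts at exponent 1: for exponent 0 the sum of powers would be 2. *)
  case: c c_gt0 {Ec} => // c _; elim: c => [|c IH]; first by rewrite !expr1.
  have -> : y setT ^+ e * (upper_sum G ^+ c.+2 - (y G ^+ c.+2 + y setT ^+ c.+2)) =
     upper_sum G * (y setT ^+ e * (upper_sum G ^+ c.+1 - (y G ^+ c.+1 + y setT ^+ c.+1)))
     + (y G ^+ c.+1 + y setT ^+ c.+1) * (y setT ^+ e * (upper_sum G - (y G + y setT)))
     + (y G ^+ c + y setT ^+ c) * (y G * y setT ^+ e.+1).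
    by rewrite !exprS; ring.
  apply: (chow_idealD hI); last exact: (chow_idealM hI).
  by apply: (chow_idealD hI); apply: (chow_idealM hI).
have -> : y F * y G ^+ c * y setT ^+ e + y F * y setT ^+ (c + e) =
  y setT ^+ e * (y F * upper_sum G ^+ c)
  - y F * (y setT ^+ e * (upper_sum G ^+ c - (y G ^+ c + y setT ^+ c))).
  by rewrite exprD; ring.
apply: chow_idealB; apply: (chow_idealM hI) => //.
by apply: flat_var_upper_sum_pow => //; rewrite Ec.
Qed.

Local Notation prodv s := (\prod_(F <- s) y F).

Definition above F (s : seq {set T}) := all (fun H => flat M H && (F \proper H)) s.

Lemma prodv_nseq n F : prodv (nseq n F) = y F ^+ n.
Proof. by elim: n => [|n IH]; rewrite ?big_nil // big_cons IH exprS. Qed.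

Lemma prodv_rem F s : F \in s -> prodv s = y F * prodv (rem F s).
Proof. by move=> Fs; rewrite (perm_big _ (perm_to_rem Fs)) big_cons. Qed.

Lemma prodv_count G s :
  prodv s = y G ^+ count_mem G s * prodv (filter (predC1 G) s).
Proof.
elim: s => [|F s IH]; first by rewrite !big_nil mulr1.
rewrite big_cons IH /=; have [->|nFG] := eqVneq F G => /=.
  by rewrite add1n exprS mulrA.
by rewrite big_cons mulrCA.
Qed.

Lemma size_filter_predC1 G s : (count_mem G s + size (filter (predC1 G) s))%N = size s.
Proof. by rewrite size_filter count_predC. Qed.

(** * Feichtner-Yuzvinsky monomials *)

Section FYInduction.
Variable Q : {set T} -> nat -> P -> Prop.
Hypothesis Q0 : forall F e, Q F e 0.
Hypothesis QB : forall F e p q, Q F e p -> Q F e q -> Q F e (p - q).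
Hypothesis QI : forall F e p q, I (y F * (p - q)) -> Q F e q -> Q F e p.
Hypothesis QE : forall F e, flat M F -> F != setT -> (rk F + e < d.+1)%N ->
  Q F e (y setT ^+ e).
Hypothesis QG : forall F G a e u, flat M F -> flat M G -> F \proper G -> G != setT ->
  (0 < a)%N -> (rk F + a < rk G)%N -> Q G e u -> Q F (a + e) (y G ^+ a * u).

Lemma FY_sum F e (J : Type) (r : seq J) (p : pred J) (h : J -> P) :
  (forall j, p j -> Q F e (h j)) -> Q F e (\sum_(j <- r | p j) h j).
Proof.
move=> hh; apply: big_rec => [|j q /hh Qj Qq]; first exact: Q0.
by rewrite -[h j]opprK addrC; apply: QB => //; rewrite -sub0r; apply: QB.
Qed.

(** Straightening of a product over flats above [F], by induction on [F] from the top, then on a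
    lower bound [G] of the factors, then on the multiplicity of [G]. The property [Q F e p] of a
    product [p] of degree [e] will be vanishing against y_F for large [e], and then the existence of
    a normal form. *)
Lemma FY_induction F s : flat M F -> F != setT -> above F s ->
  Q F (size s) (prodv s).
Proof.
have [n] := ubnP #|~: F|; elim: n F s => // n IHn F s leF fF nFT aFs.
pose ok G t := all (fun H => [&& flat M H, G \subset H & H != F]) t.
suff step m G t : (#|~: G| < m)%N -> flat M G -> F \subset G -> ok G t ->
    Q F (size t) (prodv t).
  apply: (step #|~: F|.+1 F) => //; apply/allP => H /(allP aFs) /andP[-> pFH].
  by rewrite (proper_sub pFH) eq_sym; move: pFH; rewrite properEneq => /andP[].
elim: m G t => // m IHm G t leG fG sFG.
have [a] := ubnP (count_mem G t); elim: a t => // a IHa t leat okt.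
have [Gt|nGt] := boolP (G \in t); last first.
  have [t0|[h0 h0t]] : t = [::] \/ exists H, H \in t.
  - by case: (t) => [|H t1]; [left | right; exists H; rewrite mem_head].
  - rewrite t0 big_nil -(expr0 (y setT)); apply: QE => //.
    by rewrite addn0 -rE; apply: flat_rank_lt; rewrite ?properEneq ?nFT ?subsetT.
  (* Either the smallest factor [G'] lies below all others and replaces [G] as the bound, or some
     factor is incomparable with it and the product vanishes. *)
  case: (arg_minnP (fun H : {set T} => #|H|) h0t) => G' /= G't minG'.
  have /and3P[fG' sGG' nG'F] := allP okt _ G't.
  have ltG' : (#|~: G'| < #|~: G|)%N.
    apply: proper_card; rewrite properC properEneq sGG' andbT.
    by apply: contraNneq nGt => ->.
  have [allG'|/allPn[H Ht nG'H]] := boolP (all (fun H => G' \subset H) t).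
    apply: (IHm G') => //; first by move: ltG' leG; clear; lia.
      exact: subset_trans sGG'.
    apply/allP => H Ht; have /and3P[-> _ ->] := allP okt _ Ht.
    by rewrite (allP allG' _ Ht).
  have /and3P[fH _ _] := allP okt _ Ht.
  have nHG' : ~~ (H \subset G').
    apply: contraNN nG'H => sHG'; have := minG' H Ht.
    by move=> le; rewrite -(eqP (_ : H == G')) // eqEcard sHG'.
  apply: QI (Q0 _ _); rewrite subr0; apply: (chow_idealM hI).
  rewrite (prodv_rem Ht) (@prodv_rem G'); last first.
    have : G' \in t by []; rewrite (perm_mem (perm_to_rem Ht)) inE => /orP[/eqP EH|//].
    by rewrite EH subxx in nHG'.
  by rewrite mulrA; apply: chow_idealMr; apply: flat_var_incomparable.
have /and3P[_ _ nGF] := allP okt _ Gt.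
have pFG : F \proper G by rewrite properEneq eq_sym nGF.
have [GT|nGT] := eqVneq G setT.
  have -> : prodv t = y setT ^+ size t.
    rewrite -prodv_nseq; congr (\prod_(F <- _) y F); apply/all_pred1P/allP => H.
    by move=> /(allP okt) /and3P[_]; rewrite GT subTset.
  have [lt|ge] := ltnP (rk F + size t) d.+1; first exact: QE.
  by apply: QI (Q0 _ _); rewrite subr0; apply: flat_varT_pow.
set b := count_mem G t in leat; set t' := filter (predC1 G) t.
have b_gt0 : (0 < b)%N by rewrite -has_count has_pred1.
have okt' : above G t'.
  apply/allP => H; rewrite mem_filter /= => /andP[nHG /(allP okt) /and3P[-> sGH _]].
  by rewrite properEneq eq_sym nHG.
rewrite -(size_filter_predC1 G t) (prodv_count G t) -/b -/t'.
have [lt|ge] := ltnP (rk F + b) (rk G).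
  apply: QG => //; apply: IHn => //.
  have : (#|~: G| < #|~: F|)%N by apply: proper_card; rewrite properC.
  by move: leF; clear; lia.
pose c := (rk G - rk F)%N.
have c_gt0 : (0 < c)%N by rewrite subn_gt0; apply: flat_rank_lt.
have Ec : (rk G = rk F + c)%N by rewrite subnKC // ltnW // flat_rank_lt.
have le_cb : (c <= b)%N by move: ge; rewrite Ec leq_add2l.
pose h := upper_sum G.
(* Expanding a power of [h] adds at most one copy of [G] per factor, so the multiplicity stays below
   [b]. *)
have expand j t0 : ok G t0 -> (count_mem G t0 + j < b)%N ->
    Q F (size t0 + j) (h ^+ j * prodv t0).
  elim: j t0 => [|j IHj] t0 okt0 lt0.
    by rewrite expr0 mul1r addn0; apply: IHa => //; move: lt0 leat; clear; lia.
  rewrite exprSr -mulrA mulr_suml mulr_sumr; apply: FY_sum => H /andP[fH sGH].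
  have -> : y H * prodv t0 = prodv (H :: t0) by rewrite big_cons.
  rewrite -addSnnS; apply: (IHj (H :: t0)).
    apply/andP; split=> //; rewrite fH sGH /=.
    by apply: contraNneq nGF => EH; rewrite eqEsubset sFG -EH sGH.
  by move: lt0 => /=; case: (H == G) => /=; clear; lia.
(* As y_F h^c vanishes, y_G^b may be replaced by - (h^c - y_G^c) y_G^(b-c). The difference of powers
   contains [h - y G], a sum over flats strictly above [G], so fewer than [b] copies of [G]
   remain. *)
apply: (QI (q := y G ^+ b * prodv t' - h ^+ c * (y G ^+ (b - c) * prodv t'))).
  rewrite opprB addrC subrK mulrA; apply: chow_idealMr.
  by apply: flat_var_upper_sum_pow => //; rewrite Ec.
have -> : y G ^+ b * prodv t' - h ^+ c * (y G ^+ (b - c) * prodv t') =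
    0 - (h ^+ c - y G ^+ c) * (y G ^+ (b - c) * prodv t').
  by rewrite -{1}(subnKC le_cb) exprD; ring.
apply: QB => //; rewrite subrXX mulr_sumr mulr_suml; apply: FY_sum => i _.
have -> : h - y G = \sum_(H | flat M H && (G \proper H)) y H.
  rewrite /h /upper_sum (bigD1 G) ?fG ?subxx //= addrC addrK; apply: eq_bigl => H.
  by rewrite properEneq -andbA (eq_sym G); congr (_ && _); rewrite andbC.
rewrite !mulr_suml; apply: FY_sum => H /andP[fH pGH].
have -> : y H * (h ^+ (c.-1 - i) * y G ^+ i) * (y G ^+ (b - c) * prodv t') =
    h ^+ (c.-1 - i) * prodv (H :: nseq (i + (b - c)) G ++ t').
  by rewrite big_cons big_cat /= prodv_nseq exprD; ring.
have ltic := ltn_ord i.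
have -> : (b + size t' = size (H :: nseq (i + (b - c)) G ++ t') + (c.-1 - i))%N.
  by rewrite /= size_cat size_nseq; move: ltic le_cb c_gt0; clear; lia.
apply: expand.
  have nHF : H != F.
    by apply: contraTneq pGH => ->; rewrite properE sFG andbF.
  rewrite /ok /= fH (proper_sub pGH) nHF /= all_cat; apply/andP; split.
    by rewrite all_nseq fG subxx nGF orbT.
  by apply/allP => K; rewrite mem_filter => /andP[_ /(allP okt)].
have nHG : (H == G) = false by apply/negP => /eqP EH; rewrite EH properxx in pGH.
rewrite /= nHG count_cat count_nseq /= eqxx.
have -> : count_mem G t' = 0%N by apply/count_memPn; rewrite mem_filter /= eqxx.
by move: ltic le_cb c_gt0; clear; lia.
Qed.

End FYInduction.

(** Feichtner-Yuzvinsky monomials above [F] are shorter than this, so the base case of the induction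
    is vacuous; in the other case y_G is a factor, and the bound for [G] follows from rk F + a < rk
    G. *)
Lemma ideal_long_prod F s : flat M F -> F != setT -> above F s ->
  (d < rk F + size s)%N -> I (y F * prodv s).
Proof.
move=> fF nFT aFs.
apply: (@FY_induction (fun F e q => (d < rk F + e)%N -> I (y F * q))) => //.
- by move=> *; rewrite mulr0; apply: (chow_ideal0 hI).
- by move=> F1 e p q hp hq le; rewrite mulrBr; apply: chow_idealB; auto.
- move=> F1 e p q h hq le; apply: (@ideal_congr _ (y F1 * q)); last exact: hq.
  by rewrite -mulrBr.
- by move=> F1 e _ _ le; rewrite ltnNge -ltnS le.
move=> F1 G a e u _ _ _ _ a_gt0 lt hu le.
have -> : y F1 * (y G ^+ a * u) = y F1 * y G ^+ a.-1 * (y G * u).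
  by rewrite -{1}(prednK a_gt0) exprS; ring.
by apply: (chow_idealM hI); apply: hu; move: lt le; clear; lia.
Qed.

Definition fy_sum F (c : nat -> R) (u : {set T} -> nat -> P) : P :=
  \sum_(e < d.+1 - rk F) c e *: y setT ^+ e
  + \sum_(G | [&& flat M G, F \proper G & G != setT])
      \sum_(a < rk G - rk F | (0 < a)%N) y G ^+ a * u G a.

(* [fy_form F q]: [q] is a combination of Feichtner-Yuzvinsky monomials
   y_{G_1}^{a_1} ... y_{G_m}^{a_m} y_E^e over chains F < G_1 < ... < G_m < E,
   with 0 < a_i < rank G_i - rank G_{i-1} and e <= d - rank G_m. *)
Inductive fy_form F : P -> Prop :=
  FYForm c u of (forall G a, [&& flat M G, F \proper G & G != setT] -> fy_form G (u G a))
  : fy_form F (fy_sum F c u).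

Lemma fy_form0 F : fy_form F 0.
Proof.
have [n] := ubnP #|~: F|; elim: n F => // n IH F le.
have -> : 0 = fy_sum F (fun=> 0) (fun _ _ => 0).
  rewrite /fy_sum big1 ?add0r => [|e _]; last by rewrite scale0r.
  by rewrite big1 // => G _; rewrite big1 // => a _; rewrite mulr0.
constructor=> G a /and3P[_ pFG _]; apply: IH.
have : (#|~: G| < #|~: F|)%N by apply: proper_card; rewrite properC.
by move: le; clear; lia.
Qed.

Lemma fy_form_linear F b p q : fy_form F p -> fy_form F q -> fy_form F (b *: p + q).
Proof.
move=> fp; elim: fp q => {p}F c u _ IH q [c' u' hu'].
have -> : b *: fy_sum F c u + fy_sum F c' u' =
    fy_sum F (fun e => b * c e + c' e) (fun G a => b *: u G a + u' G a).
  rewrite /fy_sum scalerDr addrACA !scaler_sumr -!big_split /=; congr (_ + _).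
    by apply: eq_bigr => e _; rewrite scalerA scalerDl.
  apply: eq_bigr => G _; rewrite scaler_sumr -big_split; apply: eq_bigr => a _ /=.
  by rewrite mulrDr scalerAr.
by constructor=> G a hG; apply: IH => //; apply: hu'.
Qed.

Lemma fy_formT F e : (rk F + e < d.+1)%N -> fy_form F (y setT ^+ e).
Proof.
move=> le; have lt : (e < d.+1 - rk F)%N by move: le; clear; lia.
have -> : y setT ^+ e = fy_sum F (fun e' => (e' == e)%:R) (fun _ _ => 0).
  rewrite /fy_sum (bigD1 (Ordinal lt)) //= eqxx scale1r big1 ?addr0 => [|e' /negPf ne].
    by rewrite big1 ?addr0 // => G _; rewrite big1 // => a _; rewrite mulr0.
  by rewrite -val_eqE /= in ne; rewrite ne scale0r.
by constructor=> *; apply: fy_form0.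
Qed.

Lemma fy_formM F G a u : flat M G -> F \proper G -> G != setT ->
  (0 < a)%N -> (rk F + a < rk G)%N -> fy_form G u -> fy_form F (y G ^+ a * u).
Proof.
move=> fG pFG nGT a_gt0 le fu; have lt : (a < rk G - rk F)%N by move: le; clear; lia.
have -> : y G ^+ a * u =
    fy_sum F (fun=> 0) (fun H b => if (H == G) && (b == a) then u else 0).
  rewrite /fy_sum big1 ?add0r => [|e _]; last by rewrite scale0r.
  rewrite (bigD1 G) ?fG ?pFG //= (bigD1 (Ordinal lt)) //= !eqxx /=.
  rewrite big1 ?addr0 => [|b /andP[_ /negPf ne]]; last first.
    by rewrite -val_eqE /= in ne; rewrite ne mulr0.
  by rewrite big1 ?addr0 // => H /andP[_ /negPf ->]; rewrite big1 // => b _; rewrite mulr0.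
constructor=> H b _; case: ifP => [/andP[/eqP -> _] //|_]; exact: fy_form0.
Qed.

Lemma prodv_fy_form F s : flat M F -> F != setT -> above F s ->
  exists2 q, fy_form F q & I (y F * (prodv s - q)).
Proof.
apply: (@FY_induction (fun F _ p => exists2 q, fy_form F q & I (y F * (p - q)))).
- by move=> F1 _; exists 0; [exact: fy_form0 | rewrite subrr mulr0; apply: (chow_ideal0 hI)].
- move=> F1 _ p1 p2 [q1 f1 h1] [q2 f2 h2]; exists (q1 - q2).
    by rewrite addrC -scaleN1r; apply: fy_form_linear.
  have -> : y F1 * (p1 - p2 - (q1 - q2)) = y F1 * (p1 - q1) - y F1 * (p2 - q2) by ring.
  exact: chow_idealB.
- move=> F1 _ p1 p2 h [q fq hq]; exists q => //.
  by rewrite -(subrKA p2) mulrDr; apply: (chow_idealD hI).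
- move=> F1 e _ _ le; exists (y setT ^+ e); first exact: fy_formT.
  by rewrite subrr mulr0; apply: (chow_ideal0 hI).
move=> F1 G a e p fF1 fG pFG nGT a_gt0 lt [q fq hq]; exists (y G ^+ a * q).
  exact: fy_formM.
have -> : y F1 * (y G ^+ a * p - y G ^+ a * q) = y F1 * y G ^+ a.-1 * (y G * (p - q)).
  by rewrite -{1 2}(prednK a_gt0) exprS; ring.
exact: (chow_idealM hI).
Qed.

Lemma mpolyX_prodv m : exists s, [/\ above set0 s, size s = mdeg m & 'X_[m] = prodv s].
Proof.
have [r sr ->] := mpolyX_list R m; exists (map phi r); rewrite size_map; split=> //.
  by apply/allP => _ /mapP[a _ ->]; rewrite (label_flat phiP) proper0 (label_neq0 phiP).
by rewrite big_map; apply: eq_bigr => a _; rewrite flat_var_label.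
Qed.

Lemma prodv_ind (Q : P -> Prop) : Q 0 -> (forall c p q, Q p -> Q q -> Q (c *: p + q)) ->
  (forall s, above set0 s -> Q (prodv s)) -> forall p, Q p.
Proof.
move=> Q0 QL Qs; elim/mpolyind => // c m p _ _ Qp; apply: QL => //.
by have [s [as_ _ ->]] := mpolyX_prodv m; apply: Qs.
Qed.

Lemma mpoly_fy_form p : exists2 q, fy_form set0 q & I (p - q).
Proof.
elim/prodv_ind: p => [|c p1 p2 [q1 f1 h1] [q2 f2 h2]|s as_].
- by exists 0; [exact: fy_form0 | rewrite subrr; apply: (chow_ideal0 hI)].
- exists (c *: q1 + q2); first exact: fy_form_linear.
  rewrite opprD addrACA -scalerBr; apply: (chow_idealD hI) => //; exact: chow_idealZ.
have [||q fq] := @prodv_fy_form set0 s _ _ as_; first exact: flat_set0.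
  by rewrite eq_sym (rank_setT_neq0 rE).
by rewrite flat_var0 mul1r; exists q.
Qed.

(** * Nondegeneracy of the degree pairing *)

(** The subalgebra generated by the y_H with [H] above [F], closed under one generator at a time so
    that an induction can gather the factors in a list. *)
Inductive upper_alg F : P -> Prop :=
| UpperC c : upper_alg F c%:MP
| UpperD p q of upper_alg F p & upper_alg F q : upper_alg F (p + q)
| UpperM H p of flat M H & F \proper H & upper_alg F p : upper_alg F (y H * p).

Lemma upper_algM F p q : upper_alg F p -> upper_alg F q -> upper_alg F (p * q).
Proof.
move=> fp fq; elim: fp => [c|p1 p2 _ h1 _ h2|H p1 fH pFH _ h1].
- elim: fq => [c'|q1 q2 _ h1 _ h2|H q1 fH pFH _ h1].
  + by rewrite -mpolyCM; constructor.
  + by rewrite mulrDr; constructor.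
  by rewrite mulrCA; constructor.
- by rewrite mulrDl; constructor.
by rewrite -mulrA; constructor.
Qed.

Lemma upper_alg_prodv F s : above F s -> upper_alg F (prodv s).
Proof.
elim: s => [|H s IH] /=; first by rewrite big_nil -mpolyC1; constructor.
by move=> /andP[/andP[fH pFH] /IH]; rewrite big_cons; constructor.
Qed.

Lemma upper_algX F H e : flat M H -> F \proper H -> upper_alg F (y H ^+ e).
Proof.
by move=> fH pFH; rewrite -prodv_nseq; apply: upper_alg_prodv; rewrite /above all_nseq fH pFH orbT.
Qed.

Lemma upper_alg_mono F G p : F \subset G -> upper_alg G p -> upper_alg F p.
Proof.
move=> sFG; elim=> [c|p1 p2 _ h1 _ h2|H p1 fH pGH _ h1]; constructor=> //.
exact: sub_proper_trans pGH.
Qed.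

Lemma upper_alg_sum F (J : Type) (r : seq J) (Q : pred J) (h : J -> P) :
  (forall j, Q j -> upper_alg F (h j)) -> upper_alg F (\sum_(j <- r | Q j) h j).
Proof.
move=> hh; apply: big_rec => [|j p /hh hj hp]; first by rewrite -mpolyC0; constructor.
by constructor.
Qed.

Lemma upper_alg_fy_form F p : F != setT -> fy_form F p -> upper_alg F p.
Proof.
move=> nFT fp; elim: fp nFT => {F p} F c u _ IH nFT; constructor; apply: upper_alg_sum.
  move=> e _; rewrite -mul_mpolyC; apply: upper_algM; first by constructor.
  by apply: upper_algX; rewrite ?flat_setT // properEneq nFT subsetT.
move=> G hG; have /and3P[fG pFG nGT] := hG; apply: upper_alg_sum => a _.
by apply: upper_algM; [apply: upper_algX | apply: upper_alg_mono (proper_sub pFG) (IH _ _ _ _)].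
Qed.

Section Nondegeneracy.
Variable D : {linear P -> R | *%R}.
Hypothesis D_ideal : forall p, I p -> D p = 0.
Hypothesis D_homog : forall e p, p \is e.-homog -> e != d -> D p = 0.

Lemma prodv_homog F s : above F s -> prodv s \is (size s).-homog.
Proof.
elim: s => [|H s IH] /=; first by rewrite big_nil dhomog1.
move=> /andP[/andP[_ pFH] /IH hs]; rewrite big_cons -add1n; apply: dhomogM hs.
by apply: flat_var_homog; apply: contraTneq pFH => ->; rewrite properE sub0set andbF.
Qed.

(* A top-degree product whose part inside G has degree less than the rank of G
   has too many factors above G. *)
Lemma degree_low_prefix G W q e : flat M G -> G != setT -> y G * W \is e.-homog ->
  (e < rk G)%N -> upper_alg G q -> D (y G * W * q) = 0.
Proof.
move=> fG nGT hW lt uq; suff h s : above G s -> D (y G * W * prodv s * q) = 0.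
  by have := h [::] isT; rewrite big_nil mulr1.
elim: uq s => [c|p q' _ hp _ hq|H p fH pGH _ hp] s as_.
- rewrite mulrC mul_mpolyC linearZ /=.
  have [Ed|ne] := eqVneq (e + size s)%N d; last first.
    by rewrite (D_homog (dhomogM hW (prodv_homog as_))) ?mulr0.
  rewrite mulrAC D_ideal ?mulr0 //; apply: chow_idealMr; apply: ideal_long_prod => //.
  by move: lt; rewrite -Ed; clear; lia.
- by rewrite mulrDr linearD /= hp // hq // addr0.
rewrite mulrA -[_ * prodv s * y H]mulrA [prodv s * y H]mulrC.
have -> : y H * prodv s = prodv (H :: s) by rewrite big_cons.
by apply: hp; rewrite /= fH pGH.
Qed.

(** [L] is a prefix of degree rk F ending at [F], and test products above [F] isolate the terms of
    [q] one by one. The term y_G^a u_(G,a) is isolated by y_G^(m-a) with m = rk G - rk F, which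
    completes [L] to the prefix [L * y G ^+ m] for the induction on normal forms. *)
Lemma fy_form_nondegenerate F q : fy_form F q -> flat M F -> F != setT ->
  forall L W, L = y F * W -> L \is (rk F).-homog -> D (L * y setT ^+ (d - rk F)) != 0 ->
  (forall s, above F s -> D (L * q * prodv s) = 0) -> I (y F * q).
Proof.
elim=> {F q} F c u hu IH fF nFT L W EL hL nzL hD.
have pFT : F \proper setT by rewrite properEneq nFT subsetT.
have ltFd : (rk F < d.+1)%N by rewrite -rE; apply: flat_rank_lt.
have uI G a : [&& flat M G, F \proper G & G != setT] -> (0 < a < rk G - rk F)%N ->
    I (y G * u G a).
  move=> hG; have /and3P[fG pFG nGT] := hG; set m := (rk G - rk F)%N.
  have nG0 : G != set0 by apply: contraTneq pFG => ->; rewrite properE sub0set andbF.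
  have ltFG := flat_rank_lt fF pFG.
  have Em : (rk G = rk F + m)%N by rewrite subnKC // ltnW.
  have ltGd : (rk G < d.+1)%N.
    by rewrite -rE; apply: flat_rank_lt; rewrite // properEneq nGT subsetT.
  (* Larger exponents come first, so that their terms are already known to vanish. *)
  have [n] := ubnP (m - a); elim: n a => // n IHn a le_n /andP[a_gt0 lt_am].
  have m_gt0 : (0 < m)%N by apply: leq_trans lt_am.
  have homX (H : {set T}) b : H != set0 -> L * y H ^+ b \is (rk F + b).-homog.
    by move=> nH; apply: dhomogM => //; have := dhomogMn b (flat_var_homog nH); rewrite mul1n.
  apply: (IH G a hG fG nGT (L * y G ^+ m) (L * y G ^+ m.-1)).
  - by rewrite -{1}(prednK m_gt0) exprS mulrCA.
  - by rewrite Em; apply: homX.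
  (* By [flat_var_diagonal], the pairing of the longer prefix is minus that of [L]. *)
  - apply: contraNN nzL => /eqP D0; apply/eqP.
    have Ed : (d - rk F = m + (d - rk G))%N by move: ltGd Em; clear; lia.
    have := @flat_var_diagonal F G m (d - rk G) fF fG pFG nGT Em.
    rewrite subnKC // => /(_ erefl)/(chow_idealM hI W)/D_ideal.
    have -> : W * (y F * y G ^+ m * y setT ^+ (d - rk G) + y F * y setT ^+ (m + (d - rk G)))
      = L * y G ^+ m * y setT ^+ (d - rk G) + L * y setT ^+ (d - rk F).
      by rewrite -Ed EL; ring.
    by rewrite linearD /= D0 add0r.
  move=> s as_; pose b := (m - a)%N.
  have b_gt0 : (0 < b)%N by rewrite subn_gt0.
  have as' : above F (nseq b G ++ s).
    rewrite /above all_cat all_nseq fG pFG orbT /=; apply/allP => H /(allP as_).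
    by move=> /andP[-> /(proper_trans pFG)].
  have := hD _ as'; rewrite /fy_sum big_cat /= prodv_nseq.
  rewrite mulrDr mulrDl linearD /= mulr_sumr mulr_suml linear_sum big1 ?add0r; last first.
    move=> e _; rewrite -scalerAr -scalerAl linearZ /=.
    have -> : L * y setT ^+ e * (y G ^+ b * prodv s)
      = y G * (L * y G ^+ b.-1) * (y setT ^+ e * prodv s).
      by rewrite -{1}(prednK b_gt0) exprS; ring.
    rewrite (degree_low_prefix (e := (rk F + b)%N)) ?mulr0 //.
    + by rewrite mulrCA -exprS prednK // homX.
    + by rewrite Em /b; move: a_gt0 lt_am; clear; lia.
    apply: upper_algM; last exact: upper_alg_prodv.
    by apply: upper_algX; rewrite ?flat_setT // properEneq nGT subsetT.
  have uu H a' : [&& flat M H, F \proper H & H != setT] -> upper_alg H (u H a').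
    by move=> hH; apply: upper_alg_fy_form (hu _ _ hH); case/and3P: hH.
  rewrite mulr_sumr mulr_suml linear_sum (bigD1 G) //= [X in _ + X]big1 ?addr0; last first.
    move=> H /andP[hH nHG]; have /and3P[fH pFH nHT] := hH.
    have nH0 : H != set0 by apply: contraTneq pFH => ->; rewrite properE sub0set andbF.
    rewrite mulr_sumr mulr_suml linear_sum big1 // => a' a'_gt0 /=.
    (* For [H] above [G] the part inside [G] is too short, for [H] below [G] the part inside [H]; an
       incomparable pair vanishes. *)
    have [sGH|nGH] := boolP (G \subset H).
      have -> : L * (y H ^+ a' * u H a') * (y G ^+ b * prodv s)
        = y G * (L * y G ^+ b.-1) * (y H ^+ a' * u H a' * prodv s).
        by rewrite -{1}(prednK b_gt0) exprS; ring.
      apply: (degree_low_prefix (e := (rk F + b)%N)) => //.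
      + by rewrite mulrCA -exprS prednK // homX.
      + by rewrite Em /b; move: a_gt0 lt_am; clear; lia.
      apply: upper_algM; last exact: upper_alg_prodv.
      apply: upper_algM; last exact: upper_alg_mono (uu _ _ hH).
      by apply: upper_algX; rewrite // properEneq eq_sym nHG.
    have [sHG|nHG'] := boolP (H \subset G).
      have -> : L * (y H ^+ a' * u H a') * (y G ^+ b * prodv s)
        = y H * (L * y H ^+ a'.-1) * (u H a' * (y G ^+ b * prodv s)).
        by rewrite -{1}(prednK a'_gt0) exprS; ring.
      apply: (degree_low_prefix (e := (rk F + a')%N)) => //.
      + by rewrite mulrCA -exprS prednK // homX.
      + by have := ltn_ord a'; have := flat_rank_lt fF pFH; clear; lia.
      apply: upper_algM; first exact: uu.
      apply: upper_algM; first by apply: upper_algX; rewrite // properEneq nHG.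
      exact: upper_alg_mono sHG (upper_alg_prodv as_).
    apply: D_ideal.
    have -> : L * (y H ^+ a' * u H a') * (y G ^+ b * prodv s)
      = L * y H ^+ a'.-1 * u H a' * y G ^+ b.-1 * prodv s * (y G * y H).
      by rewrite -{1}(prednK b_gt0) -{1}(prednK a'_gt0) !exprS; ring.
    by apply: (chow_idealM hI); apply: flat_var_incomparable.
  rewrite mulr_sumr mulr_suml linear_sum (bigD1 (Ordinal lt_am)) //= [X in _ + X]big1 ?addr0.
    move=> hz; suff -> : L * y G ^+ m * u G a * prodv s
      = L * (y G ^+ a * u G a) * (y G ^+ b * prodv s) by [].
    by rewrite -{1}(subnK (ltnW lt_am)) exprD -/b; ring.
  move=> a' /andP[a'_gt0]; rewrite -val_eqE /= => ne_a'.
  (* Smaller exponents leave too short a part inside [G]; larger ones are already in I. *)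
  have [lt_a'|ge_a'] := ltnP a' a; last first.
    apply: D_ideal.
    have -> : L * (y G ^+ a' * u G a') * (y G ^+ b * prodv s)
      = L * y G ^+ a'.-1 * y G ^+ b * prodv s * (y G * u G a').
      by rewrite -{1}(prednK a'_gt0) exprS; ring.
    apply: (chow_idealM hI); apply: IHn; last by rewrite a'_gt0 ltn_ord.
    by move: le_n lt_am ge_a' ne_a' (ltn_ord a'); clear; lia.
  have -> : L * (y G ^+ a' * u G a') * (y G ^+ b * prodv s)
    = y G * (L * y G ^+ (a'.-1 + b)) * (u G a' * prodv s).
    by rewrite -{1}(prednK a'_gt0) exprS exprD; ring.
  apply: (degree_low_prefix (e := (rk F + (a' + b))%N)) => //.
  + by rewrite mulrCA -exprS -addSn prednK // homX.
  + by rewrite Em /b; move: lt_a' lt_am; clear; lia.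
  by apply: upper_algM; [exact: uu | exact: upper_alg_prodv].
have uS : I (\sum_(G | [&& flat M G, F \proper G & G != setT])
      \sum_(a < rk G - rk F | (0 < a)%N) y G ^+ a * u G a).
  apply: ideal_sum => G hG; apply: ideal_sum => a a_gt0.
  rewrite -(prednK a_gt0) exprSr -mulrA (prednK a_gt0).
  by apply: (chow_idealM hI); apply: uI; rewrite ?a_gt0 ?ltn_ord.
(* Induction on [e]: after multiplication by y_E^(d - rk F - e), higher powers vanish by
   [flat_varT_pow], and the nonzero pairing of [L] reads off [c e]. *)
suff c0 e : (e < d.+1 - rk F)%N -> c e = 0.
  apply: (chow_idealM hI); rewrite /fy_sum big1 ?add0r // => e _.
  by rewrite c0 ?scale0r.
have [n] := ubnP e; elim: n e => // n IHn e le_n lt_e.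
have asT b : above F (nseq b setT) by rewrite /above all_nseq flat_setT pFT orbT.
have := hD _ (asT (d - rk F - e)%N).
rewrite /fy_sum mulrDr mulrDl linearD /= [X in _ + X]D_ideal ?addr0; last first.
  by apply: chow_idealMr; apply: (chow_idealM hI).
rewrite mulr_sumr mulr_suml linear_sum (bigD1 (Ordinal lt_e)) //=.
rewrite [X in _ + X]big1 ?addr0; last first.
  move=> e'; rewrite -val_eqE /= => ne_e'; rewrite -scalerAr -scalerAl linearZ /=.
  have [lt_e'|ge_e'] := ltnP e' e.
    by rewrite IHn ?mul0r //; exact: leq_trans lt_e' le_n.
  rewrite D_ideal ?mulr0 // prodv_nseq EL.
  have -> : y F * W * y setT ^+ e' * y setT ^+ (d - rk F - e)
    = W * (y F * y setT ^+ (e' + (d - rk F - e))) by rewrite exprD; ring.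
  apply: (chow_idealM hI); apply: flat_varT_pow => //.
  by move: ge_e' ne_e' lt_e ltFd; clear; lia.
rewrite -scalerAr -scalerAl linearZ /= prodv_nseq -mulrA -exprD subnKC; last first.
  by move: lt_e; clear; lia.
by move=> /eqP; rewrite mulf_eq0 (negPf nzL) orbF => /eqP.
Qed.

Lemma pairing_nondegenerate p : D (y setT ^+ d) != 0 ->
  (forall q, D (p * q) = 0) -> I p.
Proof.
move=> nzD hp; have [q fq hq] := mpoly_fy_form p.
apply: (ideal_congr hq); rewrite -[q]mul1r -flat_var0.
apply: (@fy_form_nondegenerate set0 q fq _ _ 1 1).
- exact: flat_set0.
- by rewrite eq_sym (rank_setT_neq0 rE).
- by rewrite flat_var0 mulr1.
- by rewrite rank_set0 dhomog1.
- by rewrite mul1r rank_set0 subn0.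
move=> s _; rewrite mul1r.
have -> : q * prodv s = p * prodv s - (p - q) * prodv s by ring.
by rewrite linearB /= hp D_ideal ?subrr //; apply: chow_idealMr.
Qed.

End Nondegeneracy.

(** * Square-free monomials *)

Implicit Types s t : {set 'I_k}.

Definition label_chain (s : {set 'I_k}) :=
  [forall a in s, forall b in s, (phi a \subset phi b) || (phi b \subset phi a)].

Lemma label_chainP s a b : label_chain s -> a \in s -> b \in s ->
  (phi a \subset phi b) || (phi b \subset phi a).
Proof. by move=> /forall_inP h /h /forall_inP; apply. Qed.

Lemma label_chain_sub s t : t \subset s -> label_chain s -> label_chain t.
Proof.
move=> /subsetP sts cs; apply/forall_inP => a /sts sa; apply/forall_inP => b /sts.
exact: label_chainP.
Qed.

(** A chain of #|s| flats of rank at most #|s| has ranks 1, ..., #|s|. The variable of the largest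
    flat is traded for - y_E by [flat_var_diagonal] with exponent 1; the factor y_F of the last flat
    is displayed for the next application. *)
Lemma flag_prod s : label_chain s ->
  (forall a, a \in s -> (rk (phi a) <= #|s|)%N) ->
  exists F W, [/\ flat M F /\ F != setT, rk F = #|s|,
    F = set0 \/ (exists2 a, a \in s & F = phi a), \prod_(a in s) 'X_a = y F * W
    & I (\prod_(a in s) 'X_a * y setT ^+ (d - #|s|) - (-1) ^+ #|s| * y setT ^+ d)].
Proof.
have [j] : exists j, #|s| = j by exists #|s|.
elim: j s => [|j IH] s cs chs rks.
  exists set0, 1; rewrite cs; split.
  - by split; [exact: flat_set0 | rewrite eq_sym (rank_setT_neq0 rE)].
  - exact: rank_set0.
  - by left.
  - by rewrite (cards0_eq cs) big_set0 flat_var0 mulr1.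
  by rewrite (cards0_eq cs) big_set0 subn0 expr0 subrr; apply: (chow_ideal0 hI).
have [a0 a0s] : exists a, a \in s by apply/set0Pn; rewrite -card_gt0 cs.
case: (arg_maxnP (fun a => #|phi a|) a0s) => a /= sa maxa {a0 a0s}.
have {}sa : a \in s := sa.
have cs' : #|s :\ a| = j by have := cardsD1 a s; rewrite sa cs add1n => -[].
have lta b : b \in s :\ a -> phi b \proper phi a.
  rewrite !inE => /andP[nba sb]; rewrite properEneq (inj_eq (label_inj phiP)) nba /=.
  have [//|sab] := orP (label_chainP chs sb sa).
  have : phi a == phi b by rewrite eqEcard sab maxa.
  by move/eqP ->.
have [||b sb|F [W [[fF nFT] rF hF EF IF]]] := IH (s :\ a).
- by rewrite cs'.
- exact: label_chain_sub (subD1set s a) chs.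
- have := flat_rank_lt (label_flat phiP b) (lta b sb).
  by rewrite cs'; have := rks a sa; rewrite cs; clear; lia.
rewrite cs' in rF IF.
have pFa : F \proper phi a.
  case: hF => [->|[b sb ->]]; last exact: lta.
  by rewrite proper0 (label_neq0 phiP).
have ra : rk (phi a) = j.+1.
  by have := flat_rank_lt fF pFa; have := rks a sa; rewrite rF cs; clear; lia.
have ltd : (j < d)%N.
  rewrite -ltnS -ra -rE; apply: flat_rank_lt; first exact: label_flat phiP _.
  by rewrite properEneq (label_neqT phiP) subsetT.
have Ea : \prod_(b in s) 'X_b = y (phi a) * \prod_(b in s :\ a) 'X_b :> P.
  by rewrite (big_setD1 a) //= flat_var_label.
exists (phi a), (\prod_(b in s :\ a) 'X_b); split=> //.
- by split; [exact: label_flat phiP _ | exact: label_neqT phiP _].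
- by rewrite ra cs.
- by right; exists a.
rewrite cs Ea.
have -> : y (phi a) * \prod_(b in s :\ a) 'X_b * y setT ^+ (d - j.+1)
    - (-1) ^+ j.+1 * y setT ^+ d =
  W * (y F * y (phi a) ^+ 1 * y setT ^+ (d - j.+1) + y F * y setT ^+ (1 + (d - j.+1)))
  - (\prod_(b in s :\ a) 'X_b * y setT ^+ (d - j) - (-1) ^+ j * y setT ^+ d).
  have <- : (d - j = 1 + (d - j.+1))%N by rewrite add1n subnSK.
  by rewrite EF exprS; ring.
apply: chow_idealB => //; apply: (chow_idealM hI); apply: flat_var_diagonal => //.
- exact: label_flat phiP _.
- exact: label_neqT phiP _.
- by rewrite ra rF addn1.
by rewrite ra subnKC.
Qed.

Lemma maximal_flag_prod s : label_chain s -> #|s| = d ->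
  I (\prod_(a in s) 'X_a - (-1) ^+ d * y setT ^+ d).
Proof.
move=> chs cs; have [|F [W [_ _ _ _]]] := flag_prod chs.
  move=> a _; rewrite cs -ltnS -rE; apply: flat_rank_lt; first exact: label_flat phiP _.
  by rewrite properEneq (label_neqT phiP) subsetT.
by rewrite cs subnn expr0 mulr1.
Qed.

Section SquareFree.
Hypothesis all_flat : forall F, flat M F.
Variable D : P -> R.
Hypothesis D_linear : linear_for *%R D.
Hypothesis D_ideal : forall p, I p -> D p = 0.

Let DD p q : D (p + q) = D p + D q.
Proof. by rewrite -[p in LHS]scale1r D_linear mul1r. Qed.

Let D0 : D 0 = 0. Proof. by apply: D_ideal; apply: (chow_ideal0 hI). Qed.

Let DN p : D (- p) = - D p.
Proof. by rewrite -scaleN1r -[_ *: _]addr0 D_linear D0 addr0 mulN1r. Qed.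

(** Take [i] in [phi a] outside its predecessor in the chain, and [j] outside [phi a] in its
    successor; at an end of the chain, the empty set or E takes the missing place. *)
Lemma chain_separation s a : label_chain s -> a \in s ->
  exists i j, [/\ i \in phi a, j \notin phi a &
    forall b, b \in s -> b != a -> (i \in phi b) = (j \in phi b)].
Proof.
move=> chs sa.
have [i [ia hi]] : exists i, i \in phi a /\
    (forall b, b \in s -> b != a -> phi b \subset phi a -> i \notin phi b).
  pose Q := [pred b | [&& b \in s, b != a & phi b \subset phi a]].
  have [b0 /and3P[sb0 nb0 sub0]|none] := pickP Q.
    case: (arg_maxnP (P := Q) (fun b => #|phi b|) (i0 := b0)).
      by rewrite /= sb0 nb0.
    move=> b /and3P[sb nb sba] maxb.
    have : phi b \proper phi a by rewrite properEneq (inj_eq (label_inj phiP)) nb.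
    move=> /properP[_ [i ia nib]]; exists i; split=> // c sc nc sca.
    have le : (#|phi c| <= #|phi b|)%N by apply: maxb; rewrite /= sc nc.
    have [scb|sbc] := orP (label_chainP chs sc sb).
      by apply: contraNN nib; apply: (subsetP scb).
    by have /eqP <- : phi b == phi c by rewrite eqEcard sbc.
  have /set0Pn[i ia] := label_neq0 phiP a; exists i; split=> // b sb nb sba.
  by have := none b; rewrite /= sb nb sba.
have [j [ja hj]] : exists j, j \notin phi a /\
    (forall b, b \in s -> b != a -> phi a \subset phi b -> j \in phi b).
  pose Q := [pred b | [&& b \in s, b != a & phi a \subset phi b]].
  have [b0 /and3P[sb0 nb0 sub0]|none] := pickP Q.
    case: (arg_minnP (P := Q) (fun b => #|phi b|) (i0 := b0)).
      by rewrite /= sb0 nb0.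
    move=> b /and3P[sb nb sab] minb.
    have : phi a \proper phi b by rewrite properEneq (inj_eq (label_inj phiP)) eq_sym nb.
    move=> /properP[_ [j jb nja]]; exists j; split=> // c sc nc sac.
    have le : (#|phi b| <= #|phi c|)%N by apply: minb; rewrite /= sc nc.
    have [sbc|scb] := orP (label_chainP chs sb sc); first exact: (subsetP sbc).
    by have /eqP -> : phi c == phi b by rewrite eqEcard scb.
  have /subsetPn[j _ nja] : ~~ (setT \subset phi a).
    by rewrite subTset; exact: label_neqT phiP _.
  exists j; split=> // b sb nb sab.
  by have := none b; rewrite /= sb nb sab.
exists i, j; split=> // b sb nb.
have [sba|sab] := orP (label_chainP chs sb sa).
  by rewrite (negPf (hi b sb nb sba)); apply/esym; apply: contraNF ja; apply: (subsetP sba).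
by rewrite (hj b sb nb sab) (subsetP sab).
Qed.

(* If [a] already lies in [s], the linear relation of a pair separating [phi a] from the
   other members of [s] trades x_a for variables outside [s]. *)
Lemma squarefree_step w e :
  (forall s, label_chain s -> #|s| = e.+1 -> D (w * \prod_(b in s) 'X_b) = 0) ->
  forall a s, label_chain s -> #|s| = e -> D (w * 'X_a * \prod_(b in s) 'X_b) = 0.
Proof.
move=> hw.
have out a s : a \notin s -> label_chain s -> #|s| = e -> D (w * 'X_a * \prod_(b in s) 'X_b) = 0.
  move=> nas chs cs.
  have [/forall_inP cmp|/forall_inPn[b sb]] :=
      boolP [forall b in s, (phi a \subset phi b) || (phi b \subset phi a)].
    rewrite -mulrA -big_setU1 //=; apply: hw; last by rewrite cardsU1 nas cs.
    apply/forall_inP => b; rewrite !inE => /orP[/eqP ->|sb]; apply/forall_inP => c.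
      by rewrite !inE => /orP[/eqP ->|/cmp //]; rewrite subxx.
    rewrite !inE => /orP[/eqP ->|sc]; last exact: label_chainP chs sb sc.
    by rewrite orbC cmp.
  rewrite negb_or => /andP[nab nba]; apply: D_ideal.
  rewrite (big_setD1 b) //= mulrA; apply: chow_idealMr; rewrite -mulrA.
  by apply: (chow_idealM hI); apply: (ideal_incomparable hI).
move=> a s chs cs; have [sa|/out] := boolP (a \in s); last exact.
have [i [j [ia ja sep]]] := chain_separation chs sa.
have nout b : (i \in phi b) != (j \in phi b) -> b != a -> b \notin s.
  by move=> nij nba; apply: contraNN nij => sb; rewrite sep.
have Dsum (Q : pred 'I_k) : (forall b, Q b -> b \notin s) ->
    D (w * (\sum_(b | Q b) 'X_b) * \prod_(b in s) 'X_b) = 0.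
  move=> hQ; rewrite mulr_sumr mulr_suml (big_morph D DD D0) big1 // => b Qb.
  by apply: out => //; apply: hQ.
have EL : 'X_a = (\sum_(b | i \in phi b) 'X_b - \sum_(b | j \in phi b) 'X_b)
    - \sum_(b | [&& i \in phi b, j \notin phi b & b != a]) 'X_b
    + \sum_(b | (j \in phi b) && (i \notin phi b)) 'X_b :> P.
  have -> : \sum_(b | i \in phi b) 'X_b = \sum_(b | (i \in phi b) && (j \in phi b)) 'X_b
      + ('X_a + \sum_(b | [&& i \in phi b, j \notin phi b & b != a]) 'X_b) :> P.
    rewrite (bigID (fun b => j \in phi b)) /=; congr (_ + _).
    by rewrite (bigD1 a) ?ia //=; congr (_ + _); apply: eq_bigl => b; rewrite andbA.
  have -> : \sum_(b | j \in phi b) 'X_b = \sum_(b | (i \in phi b) && (j \in phi b)) 'X_b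
      + \sum_(b | (j \in phi b) && (i \notin phi b)) 'X_b :> P.
    rewrite (bigID (fun b => i \in phi b)) /=; congr (_ + _).
    by apply: eq_bigl => b; rewrite andbC.
  by ring.
rewrite EL mulrDr mulrDl DD Dsum ?addr0; last first.
  move=> b /andP[jb nib]; apply: nout; first by rewrite jb (negPf nib).
  by apply: contraNneq nib => ->.
rewrite mulrBr mulrBl DD DN Dsum ?subr0; last first.
  by move=> b /and3P[ib njb nba]; apply: nout => //; rewrite ib (negPf njb).
by apply: D_ideal; apply: chow_idealMr; apply: (chow_idealM hI); apply: (ideal_linear hI).
Qed.

(** The factors of the monomial are absorbed into [w] one at a time, [squarefree_step] lowering the
    size of the chains to be tested. *)
Lemma squarefree_span w e :
  (forall s, label_chain s -> #|s| = e -> D (w * \prod_(b in s) 'X_b) = 0) ->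
  forall r : seq 'I_k, size r = e -> D (w * \prod_(b <- r) 'X_b) = 0.
Proof.
elim: e w => [|e IH] w hw r.
  move=> /size0nil ->; have := hw set0; rewrite big_set0 big_nil cards0; apply=> //.
  by apply/forall_inP => b; rewrite inE.
case: r => // a r [sr]; rewrite big_cons mulrA; apply: IH => // s chs cs.
exact: (squarefree_step hw).
Qed.

End SquareFree.

End FlatVariables.

(** * Duality for the degree map *)

Section FlatDegreeDuality.
Variables (R : fieldType) (T : finType) (M : matroid T) (d k : nat) (phi : 'I_k -> {set T}).
Local Notation P := {mpoly R[k]}.
Hypothesis Ml : loopless M.
Hypothesis rE : mrank M setT = d.+1.
Hypothesis phiP : flat_labelling M phi.
Local Notation deg := (@flat_deg R T M d k phi).

(** Under the substitution y_E becomes g_E minus a variable g of rank 1; the latter is killed, and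
    only the power of g_E counts. *)
Lemma flat_degT i0 : deg (flat_var R phi i0 setT ^+ d) = (-1) ^+ d.
Proof.
rewrite /flat_deg rmorphXn /= /flat_var (negPf (rank_setT_neq0 rE)) eqxx.
rewrite rmorphN rmorph_sum /= (eq_bigr _ (fun a _ => comp_xi _ _ _ a)) (sum_xi_mem R phiP).
set x := xi R M setT; set g0 := 'X_(enum_rank (mclosure M [set i0])).
have gT : x = 'X_(enum_rank [set: T]).
  rewrite -(sum_xi R (flat_setT M)) (big_pred1 setT) // => F.
  by rewrite subTset andb_idl // => /eqP ->; exact: flat_setT.
have nF : mclosure M [set i0] != set0.
  by apply/set0Pn; exists i0; apply: (subsetP (sub_closure _ _)); rewrite inE.
have rF : (mrank M (mclosure M [set i0]) <= 1)%N by rewrite rank_closure Ml.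
have -> : (- (g0 - x)) ^+ d = x ^+ d - g0 * \sum_(i < d) (x - g0) ^+ (d.-1 - i) * x ^+ i.
  rewrite opprB -[LHS](subrK (x ^+ d)) addrC; congr (_ + _); rewrite subrXX.
  by rewrite addrAC subrr add0r mulNr.
by rewrite linearB /= dhr_deg_rank1 // subr0 gT dhr_degT // mulr1.
Qed.

Lemma flat_deg_flag s : label_chain phi s -> #|s| = d -> deg (\prod_(a in s) 'X_a) = 1.
Proof.
move=> chs cs; have /set0Pn[i0 _] := rank_setT_neq0 rE.
have := maximal_flag_prod i0 Ml rE phiP (flat_deg_ideal R d Ml phiP) chs cs.
move/(_ 1); rewrite mulr1 linearB /= -signr_odd.
have -> : (-1) ^+ odd d * flat_var R phi i0 setT ^+ d =
    ((-1) ^+ odd d : R) *: flat_var R phi i0 setT ^+ d.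
  by rewrite -mul_mpolyC rmorphXn /= rmorphN rmorph1.
rewrite linearZ /= flat_degT signr_odd -exprMn mulN1r opprK expr1n.
by move/eqP; rewrite subr_eq0 => /eqP.
Qed.

Variable I : P -> Prop.
Hypothesis hI : chow_ideal phi I.
Hypothesis Imin : forall J, chow_ideal phi J -> forall p, I p -> J p.

Lemma flat_deg_eq0 p : I p -> deg p = 0.
Proof. by move=> /(Imin (flat_deg_ideal R d Ml phiP))/(_ 1); rewrite mulr1. Qed.

Lemma flat_deg_nondegenerate p : (forall q, deg (p * q) = 0) -> I p.
Proof.
have /set0Pn[i0 _] := rank_setT_neq0 rE.
apply: (pairing_nondegenerate (i0 := i0) Ml rE phiP hI).
- exact: flat_deg_eq0.
- by move=> e q; apply: flat_deg_homog.
by rewrite /= flat_degT signr_eq0.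
Qed.

End FlatDegreeDuality.

(** Finite-dimensional linear algebra: the values of [h] on monomials form a row that the kernel of
    the Gram matrix of [D] annihilates, hence a combination of its rows, whose coefficients give
    [eta]. *)
Lemma functional_represented (R : fieldType) (k e1 e2 : nat)
    (D h : {mpoly R[k]} -> R) :
  linear_for *%R D -> linear_for *%R h ->
  (forall p, p \is e2.-homog -> (forall q, q \is e1.-homog -> D (q * p) = 0) -> h p = 0) ->
  exists2 eta, eta \is e1.-homog & forall p, p \is e2.-homog -> D (eta * p) = h p.
Proof.
move=> D_lin h_lin hker.
have lin0 (g : {mpoly R[k]} -> R) : linear_for *%R g -> g 0 = 0.
  by move=> gl; have := gl (-1) 0 0; rewrite scaler0 addr0 mulN1r addNr.
have linS (g : {mpoly R[k]} -> R) : linear_for *%R g ->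
    forall (J : finType) (c : J -> R) (p : J -> {mpoly R[k]}),
    g (\sum_j c j *: p j) = \sum_j c j * g (p j).
  move=> gl J c p; apply: (big_rec2 (fun x z => g x = z)); first exact: lin0.
  by move=> j z x _ E; rewrite gl E.
pose B1 : finType := 'X_{1..k < e1.+1}; pose B2 : finType := 'X_{1..k < e2.+1}.
(* The index types hold all monomials of degree at most [e1] or [e2]; those of smaller degree are
   replaced by 0. *)
pose b1 (i : 'I_#|B1|) : {mpoly R[k]} :=
  if mdeg (enum_val i) == e1 then 'X_[enum_val i] else 0.
pose b2 (j : 'I_#|B2|) : {mpoly R[k]} :=
  if mdeg (enum_val j) == e2 then 'X_[enum_val j] else 0.
have span (e : nat) (p : {mpoly R[k]}) : p \is e.-homog ->
  p = \sum_(i : 'I_#|{: 'X_{1..k < e.+1}}|) p@_(enum_val i) *: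
        (if mdeg (enum_val i) == e then 'X_[enum_val i] else 0).
  move=> hp; rewrite {1}(@mpolywE _ _ e.+1 p); last first.
    have [->|nz_p] := eqVneq p 0; first by rewrite msize0.
    by rewrite -mlead_deg // (dhomogP _ _ _ hp) // mlead_supp.
  rewrite (reindex_onto enum_val enum_rank) => [|m _]; last exact: enum_rankK.
  apply: eq_big => [i|i _]; first by rewrite enum_valK eqxx.
  by case: eqP => // /eqP ne; rewrite (dhomog_nemf_coeff hp ne) !scale0r.
have b1_homog i : b1 i \is e1.-homog.
  by rewrite /b1; case: ifP => E; [rewrite dhomogX | exact: dhomog0].
have b2_homog j : b2 j \is e2.-homog.
  by rewrite /b2; case: ifP => E; [rewrite dhomogX | exact: dhomog0].
pose A := \matrix_(i, j) D (b1 i * b2 j).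
pose v := \row_j h (b2 j).
have Dl q : linear_for *%R (fun p => D (q * p)).
  by move=> c p1 p2; rewrite mulrDr -scalerAr D_lin.
have Dr q : linear_for *%R (fun p => D (p * q)).
  by move=> c p1 p2; rewrite mulrDl -scalerAl D_lin.
have : (v <= A)%MS.
  rewrite submxE; apply/eqP/rowP => c; rewrite !mxE.
  pose p := \sum_j cokermx A j c *: b2 j.
  have -> : \sum_j v ord0 j * cokermx A j c = h p.
    by rewrite linS //; apply: eq_bigr => j _; rewrite mxE mulrC.
  apply: hker => [|q hq]; first by rewrite rpred_sum // => j _; rewrite rpredZ.
  rewrite (span _ _ hq) (linS _ (Dr p)) big1 // => i _.
  rewrite -/(b1 i) (linS _ (Dl (b1 i))).
  have /matrixP/(_ i c) := mulmx_coker A; rewrite !mxE => E.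
  suff -> : \sum_j cokermx A j c * D (b1 i * b2 j) = 0 by rewrite mulr0.
  by rewrite -[RHS]E; apply: eq_bigr => j _; rewrite [A i j]mxE mulrC.
move/submxP => [w vE]; exists (\sum_i w ord0 i *: b1 i).
  by rewrite rpred_sum // => i _; rewrite rpredZ.
move=> p hp; rewrite (span _ _ hp) (linS _ (Dl _)) (linS _ h_lin).
apply: eq_bigr => j _; congr (_ * _); rewrite -/(b2 j) (linS _ (Dr _)).
have /rowP/(_ j) := vE; rewrite !mxE => ->.
by apply: eq_bigr => i _; rewrite mxE.
Qed.

(** * Ideals given by generators *)

Section InIdeal.
Variables (R : nzRingType) (k : nat) (G : {mpoly R[k]} -> Prop).

Lemma in_ideal0 : in_ideal G 0.
Proof. by exists [::]; rewrite big_nil. Qed.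

Lemma in_idealD p q : in_ideal G p -> in_ideal G q -> in_ideal G (p + q).
Proof.
move=> [s [hs ->]] [t [ht ->]]; exists (s ++ t); rewrite big_cat; split=> // ag.
by rewrite mem_cat => /orP[/hs|/ht].
Qed.

Lemma in_idealM p q : in_ideal G q -> in_ideal G (p * q).
Proof.
move=> [s [hs ->]]; exists [seq (p * ag.1, ag.2) | ag <- s]; split.
  by move=> _ /mapP[ag /hs hag ->].
by rewrite big_map mulr_sumr; apply: eq_bigr => ag _; rewrite mulrA.
Qed.

Lemma in_ideal_gen g : G g -> in_ideal G g.
Proof.
move=> hg; exists [:: (1, g)]; rewrite big_seq1 mul1r; split=> // ag.
by rewrite inE => /eqP ->.
Qed.

End InIdeal.

Lemma in_ideal_min (R : fieldType) (T : finType) (k : nat) (phi : 'I_k -> {set T})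
    (G J : {mpoly R[k]} -> Prop) :
  chow_ideal phi J -> (forall g, G g -> J g) -> forall p, in_ideal G p -> J p.
Proof.
move=> hJ hG _ [s [hs ->]]; rewrite big_seq; apply: big_rec => [|ag p sag hp].
  exact: (chow_ideal0 hJ).
by apply: (chow_idealD hJ) => //; apply: (chow_idealM hJ); apply: hG; apply: hs.
Qed.

(** * The Chow ring of the permutohedral fan *)

Section BooleanMatroid.
Variable T : finType.

Fact card_submod (X Y : {set T}) : (#|X :|: Y| + #|X :&: Y| <= #|X| + #|Y|)%N.
Proof. by rewrite cardsUI. Qed.

Definition boolean_matroid : matroid T :=
  Matroid (mrank := fun X : {set T} => #|X|) (fun X => leqnn _)
    (fun X Y sXY => subset_leq_card sXY) card_submod.

Lemma flat_boolean X : flat boolean_matroid X.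
Proof. by apply/forallP => e; apply/implyP => eX /=; rewrite cardsU1 eX. Qed.

Lemma loopless_boolean : loopless boolean_matroid.
Proof. by move=> e /=; rewrite cards1. Qed.

End BooleanMatroid.

Lemma sum_enum_val (V : nmodType) (F : finType) (Q : pred F) (g : F -> V) :
  \sum_(x | Q x) g x = \sum_(a : 'I_#|{: F}| | Q (enum_val a)) g (enum_val a).
Proof.
rewrite (reindex_onto enum_val enum_rank) => [|x _]; last exact: enum_rankK.
by apply: eq_bigl => a; rewrite enum_valK eqxx andbT.
Qed.

Section Permutohedral.
Variables (R : fieldType) (n : nat).
Local Notation B := (boolean_matroid 'I_n.+1).

Definition ray_set (a : 'I_#|{: ray n}|) : {set 'I_n.+1} := val (enum_val a).

Lemma ray_label : flat_labelling B ray_set.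
Proof.
split.
- by move=> a b /val_inj /enum_val_inj.
- by move=> a; apply: flat_boolean.
- by move=> a; have /andP[] := valP (enum_val a).
- by move=> a; have /andP[] := valP (enum_val a).
move=> F _ nF nT; have hF : (F != set0) && (F != setT) by rewrite nF.
by exists (enum_rank (exist _ F hF : ray n)); rewrite /ray_set enum_rankK.
Qed.

Lemma rank_boolean : mrank B setT = n.+1.
Proof. by rewrite /= cardsT card_ord. Qed.

Lemma xmonE (C : {set ray n}) : xmon R C = \prod_(a in enum_rank @: C) 'X_a.
Proof. by rewrite big_imset // => S S' _ _; apply: enum_rank_inj. Qed.

Lemma label_chain_rays (C : {set ray n}) : is_chain C -> label_chain ray_set (enum_rank @: C).
Proof.
move=> /forall_inP hC; apply/forall_inP => _ /imsetP[S CS ->].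
apply/forall_inP => _ /imsetP[S' CS' ->].
by rewrite /ray_set !enum_rankK; have /forall_inP := hC S CS; apply.
Qed.

Local Notation alpha i := (\sum_(a | i \in ray_set a) 'X_a : PA R n).

Lemma linear_form_An (m : 'I_n.+1 -> int) :
  \sum_(S : ray n) (\sum_(i in val S) m i)%:~R *: xA R S = \sum_i (m i)%:~R *: alpha i.
Proof.
under eq_bigr do rewrite rmorph_sum scaler_suml.
rewrite (exchange_big_dep xpredT) //=; apply: eq_bigr => i _.
rewrite scaler_sumr sum_enum_val; apply: eq_bigr => a _.
by rewrite /xA enum_valK.
Qed.

Lemma I_An_ideal : chow_ideal ray_set (@I_An R n).
Proof.
split.
- exact: in_ideal0.
- exact: in_idealD.
- exact: in_idealM.
- move=> a b nab nba; apply: in_ideal_gen; left; exists [set enum_val a; enum_val b].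
  split.
    apply/forall_inPn; exists (enum_val a); first by rewrite !inE eqxx.
    apply/forall_inPn; exists (enum_val b); first by rewrite !inE eqxx orbT.
    by rewrite negb_or; apply/andP.
  rewrite /xmon big_setU1 ?inE ?big_set1 /xA ?enum_valK //.
  by apply: contraNneq nab => /enum_val_inj ->.
move=> i j; apply: in_ideal_gen; right.
have delta_sum (V : lmodType R) e (v : 'I_n.+1 -> V) :
    \sum_f ((f == e)%:Z%:~R : R) *: v f = v e.
  rewrite (bigD1 e) //= eqxx scale1r big1 ?addr0 // => f /negPf ->.
  by rewrite scale0r.
exists [ffun e => (e == i)%:Z - (e == j)%:Z]; split.
  have sum1 e : \sum_(f < n.+1) ((f == e)%:Z : int) = 1.
    by rewrite (bigD1 e) //= eqxx big1 ?addr0 // => f /negPf ->.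
  by under eq_bigr do rewrite ffunE; rewrite sumrB !sum1 subrr.
rewrite linear_form_An; under [RHS]eq_bigr do rewrite ffunE rmorphB scalerBl.
by rewrite sumrB !delta_sum.
Qed.

(** A non-face contains an incomparable pair, and an [m] of total 0 gives a combination of the
    differences [alpha i - alpha ord0]. *)
Lemma I_An_min (J : PA R n -> Prop) : chow_ideal ray_set J -> forall p, I_An p -> J p.
Proof.
move=> hJ; apply: (in_ideal_min hJ) => g [[C [nC ->]]|[m [m0 ->]]].
  have /forall_inPn[S CS /forall_inPn[S' CS']] := nC.
  rewrite negb_or => /andP[nSS' nS'S].
  have neSS' : S' != S by apply: contraNneq nSS' => ->.
  rewrite /xmon (big_setD1 S) //= (big_setD1 S') ?inE ?neSS' //= mulrA mulrC.
  by apply: (chow_idealM hJ); apply: (ideal_incomparable hJ); rewrite /ray_set !enum_rankK.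
rewrite linear_form_An.
have -> : \sum_i (m i)%:~R *: alpha i = \sum_i (m i)%:~R *: (alpha i - alpha ord0).
  under [RHS]eq_bigr do rewrite scalerBr.
  by rewrite sumrB -scaler_suml -rmorph_sum m0 scale0r subr0.
by apply: (ideal_sum hJ) => i _; apply: (chow_idealZ hJ); apply: (ideal_linear hJ).
Qed.

Local Notation degA := (@flat_deg R _ B n _ ray_set).

Lemma degA_eq0 p : I_An p -> degA p = 0.
Proof.
exact: (flat_deg_eq0 _ (@loopless_boolean _) ray_label (@I_An_min)).
Qed.

Lemma degA_xmon (C : {set ray n}) : is_chain C -> #|C| = n -> degA (xmon R C) = 1.
Proof.
move=> chC cC; rewrite xmonE.
apply: (flat_deg_flag R (@loopless_boolean _) rank_boolean ray_label).
  exact: label_chain_rays.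
by rewrite card_imset //; exact: enum_rank_inj.
Qed.

Lemma degA_nondegenerate p : (forall m, degA (p * 'X_[m]) = 0) -> I_An p.
Proof.
move=> hp.
apply: (flat_deg_nondegenerate (@loopless_boolean _) rank_boolean ray_label I_An_ideal (@I_An_min)).
exact: linear_mnm_eq0.
Qed.

(** Only the monomial 1 needs the hypothesis on [degA p]: any other raises the degree above [n],
    where the degree map vanishes. *)
Lemma degA_top p : p \is n.-homog -> degA p = 0 -> I_An p.
Proof.
move=> hp dp; apply: degA_nondegenerate => m.
have [/eqP|nm] := eqVneq (mdeg m) 0%N.
  by rewrite mdeg_eq0 => /eqP ->; rewrite mpolyX0 mulr1.
apply: (@flat_deg_homog _ _ B n _ ray_set (n + mdeg m)); last first.
  by rewrite -[X in _ != X]addn0 eqn_add2l.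
by apply: dhomogM => //; rewrite dhomogX /=.
Qed.

Lemma xmon_homog (C : {set ray n}) : xmon R C \is #|C|.-homog.
Proof.
rewrite /xmon -sum1_card; apply: (big_rec2 (fun p e => p \is e.-homog)).
  exact: dhomog1.
by move=> S e p _ hp; apply: dhomogM => //; rewrite dhomogX /= mdeg1.
Qed.

Lemma exists_maximal_chain : exists2 C : {set ray n}, is_chain C & #|C| = n.
Proof.
pose S (i : 'I_n) : {set 'I_n.+1} := [set e : 'I_n.+1 | (e <= i)%N].
have hS i : (S i != set0) && (S i != setT).
  apply/andP; split; first by apply/set0Pn; exists ord0; rewrite inE.
  by apply/eqP => /setP/(_ ord_max); rewrite !inE /= leqNgt ltn_ord.
pose r i : ray n := exist _ (S i) (hS i).
have sub (i j : 'I_n) : (i <= j)%N -> val (r i) \subset val (r j).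
  by move=> le; apply/subsetP => e; rewrite !inE => /leq_trans; apply.
exists (r @: setT).
  apply/forall_inP => _ /imsetP[i _ ->]; apply/forall_inP => _ /imsetP[j _ ->].
  by apply/orP; case: (leqP i j) => [/sub|/ltnW/sub]; [left | right].
rewrite card_imset ?cardsT ?card_ord // => i j /(congr1 val)/= /setP E; apply: val_inj.
apply/eqP; rewrite eqn_leq.
have := E (widen_ord (leqnSn n) i); have := E (widen_ord (leqnSn n) j).
by rewrite !inE /= !leqnn => -> <-.
Qed.

(** The degree map is 1 on the monomial of every maximal chain, so it returns the sum of the
    coefficients of any expansion. Conversely, as [degA_top] makes the top degree one-dimensional,
    all the weight may be put on a single chain. *)
Lemma capval_degA d (xi : PA R n) (C : {set ray n}) v : (d <= n)%N ->
  xi \is (n - d).-homog -> #|C| = d -> capval xi C v <-> degA (xi * xmon R C) = v.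
Proof.
move=> led hxi cC; split=> [[c [Ic ->]]|<-].
  have := degA_eq0 Ic; rewrite linearB linear_sum /= => /eqP; rewrite subr_eq0 => /eqP ->.
  apply: eq_bigr => tau /andP[cht /eqP ct].
  by rewrite linearZ /= degA_xmon // mulr1.
have [C0 chC0 cC0] := exists_maximal_chain.
set z := degA _; exists (fun tau => if tau == C0 then z else 0).
have E (V : lmodType R) (w : {set ray n} -> V) :
    \sum_(tau | is_chain tau && (#|tau| == n)) (if tau == C0 then z else 0) *: w tau = z *: w C0.
  rewrite (bigD1 C0) ?chC0 ?cC0 ?eqxx //= big1 ?addr0 // => tau /andP[_ /negPf ->].
  by rewrite scale0r.
rewrite E (E R^o); split; last by rewrite /Delta_An [RHS]mulr1.
apply: degA_top.
  have := xmon_homog C0; have := dhomogM hxi (xmon_homog C).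
  by rewrite cC subnK // cC0 => h h0; rewrite rpredB ?rpredZ.
by rewrite linearB linearZ /= degA_xmon // mulr1 subrr.
Qed.

End Permutohedral.

(** * Restriction to the flats of a matroid *)

Section RestrictionToFlats.
Variables (R : fieldType) (n d : nat) (M : matroid 'I_n.+1).
Local Notation B := (boolean_matroid 'I_n.+1).
Hypothesis Ml : loopless M.
Hypothesis rE : mrank M setT = d.+1.

Definition flat_set (a : 'I_#|{: flatT n M}|) : {set 'I_n.+1} := val (val (enum_val a)).

Lemma flat_label : flat_labelling M flat_set.
Proof.
split.
- by move=> a b /val_inj /val_inj /enum_val_inj.
- by move=> a; exact: valP (enum_val a).
- by move=> a; have /andP[] := valP (val (enum_val a)).
- by move=> a; have /andP[] := valP (val (enum_val a)).
move=> F fF nF nT; have hF : (F != set0) && (F != setT) by rewrite nF.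
have hF' : flat M (val (exist _ F hF : ray n)) by [].
exists (enum_rank (exist _ (exist _ F hF : ray n) hF' : flatT n M)).
by rewrite /flat_set enum_rankK.
Qed.

Lemma sum_xM i : \sum_(F : flatT n M | i \in val (val F)) xM R F
  = \sum_(a | i \in flat_set a) 'X_a.
Proof. by rewrite sum_enum_val; apply: eq_bigr => a _; rewrite /xM enum_valK. Qed.

Lemma I_M_ideal : chow_ideal flat_set (@I_M R n M).
Proof.
split.
- exact: in_ideal0.
- exact: in_idealD.
- exact: in_idealM.
- move=> a b nab nba; apply: in_ideal_gen; left; exists (enum_val a), (enum_val b).
  by rewrite /xM !enum_valK.
by move=> i j; apply: in_ideal_gen; right; exists i, j; rewrite !sum_xM.
Qed.

Lemma I_M_min (J : PM R n M -> Prop) : chow_ideal flat_set J -> forall p, I_M p -> J p.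
Proof.
move=> hJ; apply: (in_ideal_min hJ) => g [[F [F' [nFF' [nF'F ->]]]]|[i [j ->]]].
  by apply: (ideal_incomparable hJ); rewrite /flat_set !enum_rankK.
by rewrite !sum_xM; apply: (ideal_linear hJ).
Qed.

(* The image of x_S: the variable of S when S is a flat of M, and 0 otherwise. *)
Definition flat_image (S : ray n) : PM R n M := \sum_(F : flatT n M | val F == S) xM R F.

Lemma flat_image_val F : flat_image (val F) = xM R F.
Proof. by rewrite /flat_image (big_pred1 F) // => F'; rewrite (inj_eq val_inj). Qed.

Lemma flat_image_nflat S : ~~ flat M (val S) -> flat_image S = 0.
Proof.
move=> nf; rewrite /flat_image big_pred0 // => F; apply: contraNF nf => /eqP <-.
exact: valP F.
Qed.

Definition to_flats : {rmorphism PA R n -> PM R n M} :=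
  comp_mpoly [tuple flat_image (enum_val a) | a < #|{: ray n}|].

Lemma to_flatsX a : to_flats 'X_a = flat_image (enum_val a).
Proof. by rewrite /to_flats /= comp_mpolyXU -tnth_nth tnth_mktuple. Qed.

Lemma to_flatsC c : to_flats c%:MP = c%:MP.
Proof. exact: comp_mpolyC. Qed.

Lemma to_flatsZ c p : to_flats (c *: p) = c *: to_flats p.
Proof. exact: comp_mpolyZ. Qed.

Lemma to_flats_homog e p : p \is e.-homog -> to_flats p \is e.-homog.
Proof.
apply: comp_mpoly_dhomog => a; rewrite tnth_mktuple rpred_sum // => F _.
by rewrite dhomogX /= mdeg1.
Qed.

Lemma to_flats_surjective q : exists p, to_flats p = q.
Proof.
exists (q \mPo [tuple xA R (val (enum_val a)) | a < #|{: flatT n M}|]).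
rewrite [q in RHS]mpolyE comp_mpolyEX rmorph_sum; apply: eq_bigr => m _.
rewrite to_flatsZ comp_mpolyX mpolyXE_id rmorph_prod; congr (_ *: _).
apply: eq_bigr => a _.
by rewrite rmorphXn /= tnth_mktuple to_flatsX enum_rankK flat_image_val /xM enum_valK.
Qed.

(** By minimality of [I_An] it suffices to check the relations: a pair with a non-flat goes to 0,
    and the sum of the rays through [i] goes to the sum of the flats through [i]. *)
Lemma to_flats_ideal p : I_An p -> I_M (to_flats p).
Proof.
apply: (I_An_min (J := fun p => I_M (to_flats p))); split.
- by rewrite rmorph0; apply: in_ideal0.
- by move=> p1 p2 h1 h2; rewrite rmorphD; apply: in_idealD.
- by move=> p1 p2 h2; rewrite rmorphM; apply: in_idealM.
- move=> a b nab nba; rewrite rmorphM !to_flatsX.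
  have [fa|/flat_image_nflat ->] := boolP (flat M (val (enum_val a))); last first.
    by rewrite mul0r; apply: in_ideal0.
  have [fb|/flat_image_nflat ->] := boolP (flat M (val (enum_val b))); last first.
    by rewrite mulr0; apply: in_ideal0.
  apply: in_ideal_gen; left.
  exists (exist _ (enum_val a) fa : flatT n M), (exist _ (enum_val b) fb : flatT n M).
  by rewrite -!flat_image_val.
have E i : to_flats (\sum_(a | i \in ray_set a) 'X_a) =
    \sum_(F : flatT n M | i \in val (val F)) xM R F.
  rewrite rmorph_sum [RHS](partition_big val (fun S : ray n => i \in val S)) //=.
  rewrite [RHS]sum_enum_val; apply: eq_bigr => a ia; rewrite to_flatsX /flat_image.
  apply: eq_bigl => F; case: eqP => [->|]; rewrite ?andbF // andbT.
  by rewrite /ray_set in ia; rewrite ia.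
by move=> i j; rewrite rmorphB !E; apply: in_ideal_gen; right; exists i, j.
Qed.

Local Notation degA := (@flat_deg R _ B n _ (@ray_set n)).
Local Notation degM := (@flat_deg R _ M d _ flat_set).

Lemma degM_eq0 p : I_M p -> degM p = 0.
Proof. exact: (flat_deg_eq0 _ Ml flat_label (@I_M_min)). Qed.

Lemma degM_nondegenerate p : (forall q, degM (p * q) = 0) -> I_M p.
Proof. exact: (flat_deg_nondegenerate Ml rE flat_label I_M_ideal (@I_M_min)). Qed.

Lemma degM_to_flats_xmon (C : {set ray n}) : is_chain C -> #|C| = d ->
  degM (to_flats (xmon R C)) = Delta_M R M C.
Proof.
move=> chC cC; rewrite /xmon rmorph_prod /Delta_M.
under eq_bigr do rewrite /xA to_flatsX enum_rankK.
case: ifP => [/forall_inP fC|/negbT/forall_inPn[S CS nfS]]; last first.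
  by rewrite (big_setD1 S) //= flat_image_nflat // mul0r raddf0.
pose s := [set a : 'I_#|{: flatT n M}| | val (enum_val a) \in C].
have inj_s : injective (fun a : 'I_#|{: flatT n M}| => val (enum_val a)).
  by move=> a b /val_inj /enum_val_inj.
have EC : C = [set val (enum_val a) | a in s].
  apply/setP => S; apply/idP/imsetP => [CS|[a]]; last by rewrite inE => aC ->.
  exists (enum_rank (exist _ S (fC S CS) : flatT n M)); last by rewrite enum_rankK.
  by rewrite inE enum_rankK.
rewrite EC big_imset /=; last by move=> a b _ _; apply: inj_s.
under eq_bigr do rewrite flat_image_val /xM enum_valK.
apply: (flat_deg_flag R Ml rE flat_label); last by rewrite -cC EC card_imset.
apply/forall_inP => a; rewrite inE => aC; apply/forall_inP => b; rewrite inE => bC.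
by have /forall_inP := forall_inP chC _ aC; apply.
Qed.

Let le_dn : (d <= n)%N.
Proof. by have := mrank_card M setT; rewrite rE cardsT card_ord ltnS. Qed.

Lemma linear_to_flats : linear_for *%R (fun p => degM (to_flats p)).
Proof. by move=> c p q; rewrite rmorphD /= to_flatsZ linearP. Qed.

(** The difference of the two functionals vanishes on [I_An] and, by the choice of [eta], on
    square-free chain monomials of degree [d]; these suffice in degree [d] by [squarefree_span]. In
    other degrees both sides are 0. *)
Lemma represents_DeltaM_deg (eta : PA R n) : represents_DeltaM d M eta ->
  forall p, degA (eta * p) = degM (to_flats p).
Proof.
move=> [heta hcap].
pose D p := degA (eta * p) - degM (to_flats p).
have D_lin : linear_for *%R D.
  move=> c p q; rewrite /D mulrDr -scalerAr linearP linear_to_flats /=.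
  by rewrite opprD addrACA mulrBr.
have D_ideal p : I_An p -> D p = 0.
  move=> Ip; rewrite /D degA_eq0 ?degM_eq0 ?subrr //; first exact: to_flats_ideal.
  exact: in_idealM.
have D_xmon s : label_chain (@ray_set n) s -> #|s| = d -> D (1 * \prod_(b in s) 'X_b) = 0.
  move=> chs cs; pose C := [set enum_val a | a in s].
  have Es : enum_rank @: C = s.
    rewrite /C -imset_comp; apply/setP => a; apply/imsetP/idP => [[b bs ->]|sa].
      by rewrite /= enum_valK.
    by exists a; rewrite //= enum_valK.
  have chC : is_chain C.
    apply/forall_inP => _ /imsetP[a sa ->]; apply/forall_inP => _ /imsetP[b sb ->].
    exact: label_chainP chs sa sb.
  have cC : #|C| = d by rewrite card_imset //; exact: enum_val_inj.
  have := hcap C chC cC; rewrite (capval_degA _ le_dn heta cC) => E.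
  by rewrite mul1r -Es -xmonE /D E degM_to_flats_xmon // subrr.
move=> p; apply/eqP; rewrite -subr_eq0; apply/eqP; rewrite -/(D p).
elim/mpolyind: p => [|c m p _ _ IH]; first by apply: D_ideal; apply: in_ideal0.
rewrite D_lin IH addr0; have [Em|nm] := eqVneq (mdeg m) d.
  have [r sr ->] := mpolyX_list R m; rewrite Em in sr.
  have := squarefree_span (ray_label n) (I_An_ideal R n) (D := D) D_lin D_ideal D_xmon sr.
  by rewrite mul1r => ->; rewrite mulr0.
have hm : ('X_[m] : PA R n) \is (mdeg m).-homog by rewrite dhomogX /=.
rewrite /D (flat_deg_homog _ _ (dhomogM heta hm)); last first.
  by rewrite -[X in _ != X](subnK le_dn) eqn_add2l.
by rewrite (flat_deg_homog _ _ (to_flats_homog hm)) // subrr mulr0.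
Qed.

(** For [functional_represented]: a [p] of degree [d] that pairs to 0 with degree [n - d] pairs to 0
    with everything, hence lies in [I_An], and its image has degree 0. *)
Lemma exists_represents_DeltaM : exists eta : PA R n, represents_DeltaM d M eta.
Proof.
have [|p hp hk|eta heta E] := @functional_represented R _ (n - d) d
  (@flat_deg R _ B n _ (@ray_set n)) (fun p => degM (to_flats p)) _ linear_to_flats.
- by move=> c p q; rewrite linearP.
- apply: degM_eq0; apply: to_flats_ideal; apply: degA_nondegenerate => m.
  have hm : ('X_[m] : PA R n) \is (mdeg m).-homog by rewrite dhomogX /=.
  have [Em|nm] := eqVneq (mdeg m) (n - d)%N; first by rewrite mulrC hk // -Em.
  apply: flat_deg_homog (dhomogM hp hm) _.
  by rewrite -[X in _ != X](subnKC le_dn) eqn_add2l.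
exists eta; split=> // C chC cC; apply/(capval_degA _ le_dn heta cC).
by rewrite E ?degM_to_flats_xmon // -cC xmon_homog.
Qed.

(** Both memberships are tested by pairing, and [represents_DeltaM_deg] identifies the two tests
    because [to_flats] is surjective. *)
Lemma to_flats_ann (eta : PA R n) : represents_DeltaM d M eta ->
  forall p, I_M (to_flats p) <-> I_An (p * eta).
Proof.
move=> /represents_DeltaM_deg E p; split=> [Ip|Ip].
  apply: degA_nondegenerate => m; rewrite [p * eta]mulrC -mulrA E rmorphM.
  by apply: degM_eq0; apply: (chow_idealMr I_M_ideal).
apply: degM_nondegenerate => q; have [q' <-] := to_flats_surjective q.
rewrite -rmorphM -E mulrA [eta * p]mulrC; apply: degA_eq0.
exact: (chow_idealMr (I_An_ideal R n)).
Qed.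

End RestrictionToFlats.

(* A^.(M) ~= A^.(Sigma_{A_n}) / ann(Delta_M) as graded R-algebras:
   a graded R-algebra morphism f between the presenting polynomial rings,
   surjective modulo I_M, whose preimage of I_M is exactly the preimage of
   ann(Delta_M) = {xi : xi * eta = 0 in A^.(Sigma_{A_n})}. *)
Theorem theorem4p5 (R : realType) (n d : nat) (M : matroid 'I_n.+1) :
  loopless M -> mrank M setT = d.+1 ->
  (exists eta : PA R n, represents_DeltaM d M eta) /\
  forall eta : PA R n, represents_DeltaM d M eta ->
    exists f : {rmorphism PA R n -> PM R n M},
      (forall c : R, f c%:MP = c%:MP) /\
      (forall (k : nat) (p : PA R n), p \is k.-homog -> f p \is k.-homog) /\
      (forall p : PA R n, I_M (f p) <-> I_An (p * eta)) /\
      (forall q : PM R n M, exists p : PA R n, I_M (f p - q)).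
Proof.
move=> Ml rE; split; first exact: exists_represents_DeltaM.
move=> eta heta; exists (to_flats R M); split; first exact: to_flatsC.
split; first by move=> k p; apply: to_flats_homog.
split; first exact: to_flats_ann heta.
move=> q; have [p <-] := to_flats_surjective q; exists p; rewrite subrr.
exact: in_ideal0.
Qed.
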